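(* Let $(Y_i)_{i\in\mathbb Z}$ be a strictly stationary sequence of real-valued random variables with marginal density $f$ with respect to Lebesgue measure $\lambda$ on $\mathbb R$. Let $K\in\mathbb L^1(\mathbb R,\lambda)$ be a function of bounded variation, let $(h_n)_{n\ge1}$ be a sequence of positive real numbers, and let $$f_n(x)=\frac1{nh_n}\sum_{k=1}^nK\big(h_n^{-1}(x-Y_k)\big).$$ Let $V_{1,2,Y}(n)=\sum_{k=0}^n\beta_{1,Y}(k)$. The following hold, with constants $C>0$ not depending on $n$, for all positive integers $n$. 1. For $p=2$, $$\mathbb E\Big(\int_{\mathbb R}|f_n(x)-\mathbb E(f_n(x))|^2dx\Big)\le \frac{C}{nh_n}\|dK\|\,\|K\|_{1,\lambda}V_{1,2,Y}(n).$$ 2. Let $1\le p<2$, $\alpha>1$, $q>1$, and let $U_{1,q,Y}(n)=\sum_{k=0}^n(k+1)^{\frac1{q-1}}\beta_{1,Y}(k)$. If $$M_{\alpha q,p}(f):=\int|x|^{\frac{\alpha q(2-p)}p}f(x)\,dx<\infty\quad\text{and}\quad M_{\alpha,p}(K):=\int|x|^{\frac{\alpha(2-p)}p}|K(x)|\,dx<\infty,$$ then $$\mathbb E\Big(\int_{\mathbb R}|f_n(x)-\mathbb E(f_n(x))|^pdx\Big)\le C\left(\frac{\|dK\|\,\|K\|_{1,\lambda}(M_{\alpha q,p}(f))^{\frac1q}(U_{1,q,Y}(n))^{\frac{q-1}q}}{nh_n}\right)^{\frac p2}+C\left(\frac{\|dK\|\big(\|K\|_{1,\lambda}+h_n^{\frac{\alpha(2-p)}p}M_{\alpha,p}(K)\big)V_{1,2,Y}(n)}{nh_n}\right)^{\frac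 p2}.$$
   Context: $\|dK\|$ is the total variation norm of the measure $dK$; $\|\cdot\|_{1,\lambda}$ is the $\mathbb L^1(\mathbb R,\lambda)$-norm. Dependence coefficients: let $P$ be the law of $Y_0$, $\mathcal F_\ell=\sigma(Y_i,i\le\ell)$, and let $P_{Y_k|\mathcal F_\ell}$ be the conditional distribution of $Y_k$ given $\mathcal F_\ell$. With $f_t=\mathbf 1_{]-\infty,t]}$ for $t\in\mathbb R$ and $Q(g)=\int g\,dQ$, let $b_\ell(k)=\sup_{t\in\mathbb R}|P_{Y_k|\mathcal F_\ell}(f_t)-P(f_t)|$ and $\beta_{1,Y}(k)=\mathbb E(b_0(k))$. *)

(* Defs.v *)
From HB Require Import structures.
From mathcomp Require Import all_boot all_order all_algebra.
From mathcomp Require Import lra.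
From mathcomp Require Import all_classical all_reals all_analysis.

Set Implicit Arguments.
Unset Strict Implicit.
Unset Printing Implicit Defensive.

Import Order.TTheory GRing.Theory Num.Theory.
Import numFieldNormedType.Exports.

Local Open Scope classical_set_scope.
Local Open Scope ring_scope.

Section finite_variation.
Context {R : realType}.
Implicit Types (K g : R -> R).

(* Bounded variation on the whole line, with one bound for all segments. *)
Definition bounded_variationT K :=
  exists M : R, forall a b, a <= b -> (total_variation a b K <= M%:E)%E.

Definition right_lim K (x : R) : R := lim (K y @[y --> x^'+]).

(* [nu] is the finite signed measure dK. Since K need not be right-continuous,
   the mass of ]a, b] is K(b+) - K(a+), which does not depend on the values
   taken by K at its countably many points of discontinuity. *)
Definition is_stieltjes_charge K (nu : {charge set (measurableTypeR R) -> \bar R}) :=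
  forall a b, a <= b ->
    nu `]a, b]%classic = (right_lim K b - right_lim K a)%:E.

Lemma right_lim_nd g M x : nondecreasing g -> (forall x, `|g x| <= M) ->
  g y @[y --> x^'+] --> right_lim g x.
Proof.
move=> nd gM; apply: nondecreasing_at_right_is_cvgr; near=> y.
  by move=> s t _ _; exact: nd.
exists (- M) => _ [t _ <-].
by have := gM t; rewrite ler_norml => /andP[].
Unshelve. all: by end_near. Qed.

Lemma right_lim_ge g M x : nondecreasing g -> (forall x, `|g x| <= M) ->
  g x <= right_lim g x.
Proof.
move=> nd gM; apply: limr_ge; first exact: (right_lim_nd (M := M)).
near=> y; apply: nd; near: y; exact: nbhs_right_ge.
Unshelve. all: by end_near. Qed.

Lemma right_lim_le g M x y : nondecreasing g -> (forall x, `|g x| <= M) ->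
  x < y -> right_lim g x <= g y.
Proof.
move=> nd gM xy; apply: limr_le; first exact: (right_lim_nd (M := M)).
near=> z; apply: nd; near: z; exact: nbhs_right_le.
Unshelve. all: by end_near. Qed.

Lemma right_lim_nondecreasing g M :
  nondecreasing g -> (forall x, `|g x| <= M) -> nondecreasing (right_lim g).
Proof.
move=> nd gM x y; rewrite le_eqVlt => /predU1P[->//|xy].
exact: le_trans (right_lim_le nd gM xy) (right_lim_ge y nd gM).
Qed.

Lemma right_lim_bounded g M :
  nondecreasing g -> (forall x, `|g x| <= M) -> forall x, `|right_lim g x| <= M.
Proof.
move=> nd gM x; rewrite ler_norml; apply/andP; split.
  apply: le_trans (right_lim_ge x nd gM).
  by have := gM x; rewrite ler_norml => /andP[].
apply: (le_trans (@right_lim_le g M x (x + 1) nd gM _)); first by rewrite ltrDl.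
by have := gM (x + 1); rewrite ler_norml => /andP[].
Qed.

Lemma right_lim_right_continuous g M :
  nondecreasing g -> (forall x, `|g x| <= M) -> right_continuous (right_lim g).
Proof.
move=> nd gM x; apply/cvgrPdist_le => e e0.
have /cvgrPdist_le/(_ _ e0) H := right_lim_nd (x := x) nd gM.
have [d /= d0 Hd] := H.
near=> z.
have xz : x < z by near: z; exact: nbhs_right_gt.
rewrite distrC ger0_norm; last first.
  by rewrite subr_ge0; apply: (right_lim_nondecreasing nd gM); exact: ltW.
have zd : z < x + d by near: z; apply: nbhs_right_lt; rewrite ltrDl.
pose w := (z + (x + d)) / 2.
have zw : z < w by rewrite midf_lt.
have wd : w < x + d by rewrite midf_lt.
have xw : x < w by exact: lt_trans zw.
have := Hd w; rewrite /ball_/= distrC gtr0_norm ?subr_gt0// ltrBlDl.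
move=> /(_ wd xw); rewrite distrC => /(le_trans (ler_norm _)).
by apply: le_trans; rewrite lerB//; exact: (right_lim_le nd gM).
Unshelve. all: by end_near. Qed.

Lemma ex_stieltjes_charge_nd g M : nondecreasing g -> (forall x, `|g x| <= M) ->
  exists nu, is_stieltjes_charge g nu.
Proof.
move=> nd gM.
have ndG := right_lim_nondecreasing nd gM.
have bG := right_lim_bounded nd gM.
pose m1 := isCumulative.Build R _ R (right_lim g) ndG
  (right_lim_right_continuous nd gM).
pose G : cumulative R R := HB.pack (right_lim g) m1.
pose mu := lebesgue_stieltjes_measure G.
have muE a b : a <= b -> mu `]a, b]%classic = (right_lim g b - right_lim g a)%:E.
  move=> ab; rewrite /mu /lebesgue_stieltjes_measure.
  rewrite /measure_extension measurable_mu_extE/=; last exact: is_ocitv.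
  by rewrite wlength_itv_bnd.
have muT : (mu setT <= (M + M)%:E)%E.
  rewrite -(bigcup_itvT false false).
  pose I n : set R := `]- (n%:R), n%:R]%classic.
  have H : (mu \o I) n @[n --> \oo] --> mu (\bigcup_n I n).
    apply: nondecreasing_cvg_mu; rewrite /I//; first exact: bigcup_measurable.
    by move=> *; apply/subsetPset/subset_itv; rewrite leBSide/= ?lerN2 ler_nat.
  rewrite -(cvg_lim _ H)//; apply: lime_le; first by apply/cvg_ex; eexists; exact: H.
  near=> n; rewrite /= muE ?ge0_cp// lee_fin.
  rewrite (le_trans (ler_norm _))// (le_trans (ler_normB _ _))// lerD//; exact: bG.
have fmu : fin_num_fun mu.
  by apply: lty_fin_num_fun; exact: le_lt_trans muT (ltry _).
pose m2 := @Measure_isFinite.Build _ _ _ mu fmu.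
pose fm : {finite_measure set (measurableTypeR R) -> \bar R} := HB.pack mu m2.
exists (charge_of_finite_measure fm) => a b ab.
by rewrite /charge_of_finite_measure/= muE.
Unshelve. all: by end_near. Qed.

Lemma bounded_variationT_decomp K : bounded_variationT K ->
  exists g1 g2 M, [/\ nondecreasing g1, nondecreasing g2,
    (forall x, `|g1 x| <= M) /\ (forall x, `|g2 x| <= M) & K = g1 \- g2].
Proof.
move=> [M KM]; pose V a b := fine (total_variation a b K).
have Vfin a b : a <= b -> total_variation a b K \is a fin_num.
  move=> ab; rewrite ge0_fin_numE ?total_variation_ge0//.
  exact: le_lt_trans (KM _ _ ab) (ltry _).
have V0 a b : a <= b -> 0 <= V a b.
  by move=> ab; exact/fine_ge0/total_variation_ge0.
have VM a b : a <= b -> V a b <= M.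
  by move=> ab; rewrite -lee_fin fineK ?Vfin//; exact: KM.
have VK a b : a <= b -> `|K b - K a| <= V a b.
  by move=> ab; rewrite -lee_fin fineK ?Vfin//; exact: total_variation_ge.
have VD a b c : a <= c -> c <= b -> V a b = V a c + V c b.
  by move=> ac cb; rewrite /V (total_variationD K ac cb) fineD// Vfin.
pose g1 x := if 0 <= x then V 0 x else - V x 0.
have g1B x y : x <= y -> g1 y - g1 x = V x y.
  move=> xy; rewrite /g1; case: (leP 0 x) => x0.
    by rewrite (le_trans x0 xy) (VD 0 y x)// addrC addKr.
  case: (leP 0 y) => y0.
    by rewrite (VD x y 0) ?(ltW x0)// opprK addrC.
  by rewrite (VD x 0 y) ?(ltW y0)// opprK addrCA addNr addr0.
have nd1 : nondecreasing g1.
  by move=> x y xy; rewrite -subr_ge0 g1B// V0.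
have b1 x : `|g1 x| <= M.
  rewrite /g1; case: (leP 0 x) => x0; first by rewrite ger0_norm ?V0 ?VM.
  by rewrite normrN ger0_norm ?V0 ?VM// ltW.
exists g1, (g1 \- K), (M + (`|K 0| + M)); split => //.
- move=> x y xy /=; have := le_trans (ler_norm _) (VK _ _ xy).
  by rewrite -g1B//; lra.
- have M0 : 0 <= M by rewrite (le_trans _ (b1 0)).
  split=> x; first by rewrite (le_trans (b1 x))// lerDl addr_ge0.
  rewrite /= (le_trans (ler_normB _ _))// lerD//.
  rewrite -[K x](subrK (K 0)) addrC (le_trans (ler_normD _ _))// lerD2l.
  have [x0|/ltW x0] := leP 0 x; first exact: le_trans (VK _ _ x0) (VM _ _ x0).
  by rewrite distrC; exact: le_trans (VK _ _ x0) (VM _ _ x0).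
- by apply/funext => x /=; rewrite opprB addrC subrK.
Qed.

Lemma ex_stieltjes_charge K :
  bounded_variationT K -> exists nu, is_stieltjes_charge K nu.
Proof.
move=> /bounded_variationT_decomp[g1 [g2 [M [nd1 nd2 [b1 b2] KE]]]].
have [nu1 nu1E] := ex_stieltjes_charge_nd nd1 b1.
have [nu2 nu2E] := ex_stieltjes_charge_nd nd2 b2.
have KlimE x : right_lim K x = right_lim g1 x - right_lim g2 x.
  apply/cvg_lim => //; rewrite KE.
  exact: cvgB (right_lim_nd nd1 b1) (right_lim_nd nd2 b2).
exists (cadd nu1 (cscale (-1) nu2)) => a b ab.
transitivity (nu1 `]a, b]%classic + (-1)%:E * nu2 `]a, b]%classic)%E; first by [].
rewrite (nu1E _ _ ab) (nu2E _ _ ab) !KlimE -EFinM -EFinD mulN1r.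
by congr (_%:E); lra.
Qed.

Definition stieltjes_charge K (bvK : bounded_variationT K) :
  {charge set (measurableTypeR R) -> \bar R} := projT1 (cid (ex_stieltjes_charge bvK)).

Lemma stieltjes_chargeE K (bvK : bounded_variationT K) :
  is_stieltjes_charge K (stieltjes_charge bvK).
Proof. exact: (projT2 (cid (ex_stieltjes_charge bvK))). Qed.

End finite_variation.

Section total_variation_norm.
Context {R : realType}.

(* |nu|(T), where |nu| is the sum of the positive and negative parts of nu in
   some Hahn decomposition of T; it does not depend on the decomposition. *)
Definition charge_norm d (T : measurableType d)
    (nu : {charge set T -> \bar R}) : R :=
  let exN := projT2 (cid (Hahn_decomposition nu)) in
  fine (charge_variation (projT2 (cid exN)) setT).

End total_variation_norm.

Section dependent_sequence.
Context d (T : measurableType d) (R : realType) (P : probability T R).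
Variable Y : int -> {RV P >-> R}.

(* The product sigma-algebra on R^Z is generated by these sets. *)
Definition cylinder : set (set (int -> R)) :=
  [set (fun y : int -> R => y i) @^-1` B | i in [set: int] & B in measurable].

Definition strictly_stationary := forall (m : int) (A : set (int -> R)),
  <<s cylinder >> A ->
  P [set w | A (fun i => Y (i + m) w)] = P [set w | A (fun i => Y i w)].

Definition is_density (f : R -> R) :=
  [/\ measurable_fun setT f, forall x, 0 <= f x &
      forall B, measurable B ->
        (distribution P (Y 0) B = \int[lebesgue_measure]_(x in B) (f x)%:E)%E].

(* The sigma-algebra F_l = sigma(Y_i, i <= l) is [<<s past l >>]. *)
Definition past (l : int) : set (set T) :=
  \bigcup_(i in [set i | i <= l]) preimage_set_system setT (Y i) measurable.

(* Being a kernel from [g_sigma_algebraType (past l)] means that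
   [fun w => Q w B] is F_l-measurable for every Borel set B. *)
Definition is_cond_distribution (k l : int)
    (Q : R.-pker (g_sigma_algebraType (past l)) ~> (measurableTypeR R)) :=
  forall (A : set T) (B : set R), <<s past l >> A -> measurable B ->
    (\int[P]_(w in A) Q w B = P (A `&` Y k @^-1` B))%E.

Variable Q : forall k l : int,
  R.-pker (g_sigma_algebraType (past l)) ~> (measurableTypeR R).

Definition b_coef (l k : int) (w : T) : R :=
  sup [set `| \int[Q k l w]_x \1_(`]-oo, t]) x
              - \int[distribution P (Y 0)]_x \1_(`]-oo, t]) x | | t in [set: R]].

Definition beta1 (k : nat) : R := fine 'E_P[b_coef 0 k%:Z].

Definition V12 (n : nat) : R := \sum_(0 <= k < n.+1) beta1 k.

Definition U1 (q : R) (n : nat) : R :=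
  \sum_(0 <= k < n.+1) k.+1%:R `^ (1 / (q - 1)) * beta1 k.

Variables (K : R -> R) (h : nat -> R).

Definition density_estimator (n : nat) (w : T) (x : R) : R :=
  (n%:R * h n)^-1 * \sum_(1 <= k < n.+1) K ((h n)^-1 * (x - Y k%:Z w)).

Definition risk (p : R) (n : nat) : \bar R :=
  (\int[P]_w \int[lebesgue_measure]_x
     (`| density_estimator n w x
         - fine 'E_P[fun w' => density_estimator n w' x] | `^ p)%:E)%E.

End dependent_sequence.

Definition moment {R : realType} (a : R) (g : R -> R) : \bar R :=
  (\int[lebesgue_measure]_x (`|x| `^ a * g x)%:E)%E.

(* Main.v *)
Require Import Defs.
From HB Require Import structures.
From mathcomp Require Import all_boot all_order all_algebra.
From mathcomp Require Import ring lra.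
From mathcomp Require Import all_classical all_reals all_analysis.
From mathcomp Require Import measurable_realfun.

Set Implicit Arguments.
Unset Strict Implicit.
Unset Printing Implicit Defensive.

Import Order.TTheory GRing.Theory Num.Theory.
Import numFieldNormedType.Exports.

Local Open Scope classical_set_scope.
Local Open Scope ring_scope.

(** Write [G k x] for [K ((x - Y k) / h n)]. The estimator minus its mean is the
    sum over [k <= n] of the centered [G k x], divided by [n * h n], so its second
    moment at [x] is a sum of covariances, and by stationarity these depend on
    the lag only.

    The covariances are controlled through the bounded variation of [K]. Off a
    countable set [K] agrees with its right limit, which is a constant plus the
    difference of the distribution functions of the two Jordan parts of dK, and
    a distribution function is a superposition of indicators of half-lines.
    For such an indicator, conditioning on the past gives
    [|cov (Z, 1_(Y k <= t))| <= E (|Z| * b_coef 0 k)] when [Z] is a bounded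
    function of [Y 0], because [b_coef 0 k] is the Kolmogorov distance between
    the conditional law of [Y k] and its law. Integrating over dK yields the same
    bound for [cov (Z, G k x)] with the factor [||dK||] ([cov_kernel_le]; the
    countable exceptional set is harmless because [Y k] has a density).

    Taking [Z = G 0 x], summing over lags and integrating in [x] against a weight
    [om] by Tonelli's theorem gives [weighted_variance_le]: the weighted
    integrated variance is at most [2 * ||dK|| / (n * h ^ 2)] times
    [E (Phi (Y 0) * sum_j b_coef 0 j)], where [Phi y] bounds the integral of
    [om x * |K ((x - y) / h)|]. The weight [1], for which [Phi] is
    [h * ||K||_1], is the case [p = 2].

    For [p < 2] the weight is [(1 + |x|) ^ s] with [s = alpha * (2 - p) / p]. The
    Hoelder inequality against [(1 + |x|) ^ (- alpha)], which is integrable, bounds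
    the p-th risk by the power [p / 2] of the weighted variance
    ([risk_le_weighted]). Here [Phi] grows like [|y| ^ s], and the term
    [E (|Y 0| ^ s * sum_j b_coef 0 j)] is separated by the Hoelder inequality with
    exponents [q] and [r = q / (q - 1)]; the r-th power of the sum of the
    coefficients is brought back to a weighted sum by [powR_sum_le], an
    elementary inequality for numbers between [0] and [1] ([moment_b_sum_le]). The
    two terms of the result come apart by subadditivity of the power [p / 2]. *)

(** * Integrals against image and density measures *)

Section density.
Local Open Scope ereal_scope.
Context d1 d2 (X : measurableType d1) (Z : measurableType d2) (R : realType).
Variables (phi : X -> Z) (mphi : measurable_fun setT phi).
Variables (mu : {measure set X -> \bar R}) (m : {measure set Z -> \bar R}).
Variables (D : X -> R) (mD : measurable_fun setT D) (D0 : forall x, (0 <= D x)%R).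
Hypothesis mE : forall B, measurable B -> m B = \int[mu]_(x in phi @^-1` B) (D x)%:E.

Import HBNNSimple.

Let density_nnsfun (g : {nnsfun Z >-> R}) :
  \int[m]_z (g z)%:E = \int[mu]_x ((g (phi x))%:E * (D x)%:E).
Proof.
have mI r : measurable_fun setT (fun x => (\1_(g @^-1` [set r]) (phi x))%:E * (D x)%:E).
  apply: emeasurable_funM; last exact/measurable_EFinP.
  apply/measurable_EFinP.
  exact: measurableT_comp mphi.
have e1 : (fun x => (g (phi x))%:E * (D x)%:E) =
    (fun x => \sum_(r \in range g) r%:E * ((\1_(g @^-1` [set r]) (phi x))%:E * (D x)%:E)).
  apply/funext => x; rewrite fimfunE -fsumEFin// ge0_mule_fsuml; last first.
    by move=> r; rewrite lee_fin; have := nnfun_muleindic_ge0 g r (phi x); rewrite lee_fin.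
  by apply: eq_fsbigr => r _; rewrite EFinM muleA.
rewrite e1 ge0_integral_fsum//; last 2 first.
- by move=> r; apply: measurable_funeM.
- move=> r x _; rewrite muleA mule_ge0//.
    exact: nnfun_muleindic_ge0 g r (phi x).
  by rewrite lee_fin.
under eq_integral do rewrite fimfunE -fsumEFin//.
rewrite ge0_integral_fsum//; last 2 first.
- by move=> r; exact/measurable_EFinP/measurable_funM.
- by move=> r x _; rewrite nnfun_muleindic_ge0.
apply: eq_fsbigr => r /set_mem[z _ <-].
rewrite integralZl_indic_nnsfun// integral_indic// setIT mE//.
rewrite ge0_integralZl_EFin//; last by move=> x _; rewrite mule_ge0 ?lee_fin.
congr (_ * _); rewrite integral_mkcond; apply: eq_integral => x _.
rewrite patchE indicE -[x \in _]/(phi x \in g @^-1` [set g z]).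
by case: ifPn => _; rewrite ?mul1e ?mul0e.
Qed.

(** Integration against a measure given by a density along a map, from its
    values on measurable sets. It serves for change of variables, for the passage
    from the law of [Y 0] to the density [f], and for the extension of the
    defining property of conditional distributions from events to functions. *)
Lemma ge0_integral_density (g : Z -> R) : measurable_fun setT g ->
  (forall z, (0 <= g z)%R) ->
  \int[m]_z (g z)%:E = \int[mu]_x (g (phi x) * D x)%:E.
Proof.
move=> mg g0; have mg' : measurable_fun setT (EFin \o g) by exact/measurable_EFinP.
pose g_ := nnsfun_approx measurableT mg'.
have gg z : (EFin \o g_^~ z) n @[n --> \oo] --> (g z)%:E.
  by apply: (cvg_nnsfun_approx measurableT mg') => // x _; rewrite lee_fin.
have nd z a b : (a <= b)%N -> (g_ a z <= g_ b z)%R.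
  by move=> ab; exact/lefP/nd_nnsfun_approx.
transitivity (limn (fun n => \int[m]_z (g_ n z)%:E)).
  rewrite -monotone_convergence//.
  - by apply: eq_integral => z _; apply/esym/cvg_lim => //; exact: gg.
  - by move=> n; exact/measurable_EFinP.
  - by move=> n z _; rewrite lee_fin.
  - by move=> z _ a b ab; rewrite lee_fin nd.
under eq_fun do rewrite density_nnsfun.
rewrite -monotone_convergence//.
- apply: eq_integral => x _; apply/cvg_lim => //; rewrite EFinM.
  apply: cvgeM; [by []|exact: gg|exact: cvg_cst].
- move=> n; apply: emeasurable_funM; last exact/measurable_EFinP.
  by apply/measurable_EFinP; exact: measurableT_comp mphi.
- by move=> n x _; rewrite mule_ge0 ?lee_fin//.
- by move=> x _ a b ab; rewrite lee_wpmul2r ?lee_fin// nd.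
Qed.

End density.

Section affine.
Context {R : realType}.
Local Notation lambda := (@lebesgue_measure R).

(** Both sides integrate [g] against a measure; uniqueness of the Lebesgue measure
    reduces the equality of the two measures to the lengths of intervals. *)
Lemma ge0_integral_affine (g : R -> R) (y h : R) : 0 < h ->
  measurable_fun setT g -> (forall x, 0 <= g x) ->
  (\int[lambda]_x (g x)%:E = \int[lambda]_u (h * g (y + h * u))%:E)%E.
Proof.
move=> h0 mg g0; pose phi u := y + h * u.
have mphi : measurable_fun [set: measurableTypeR R] (phi : _ -> measurableTypeR R).
  by apply: measurable_funD => //; exact: measurable_funM.
pose mphi_mixin := isMeasurableFun.Build _ _ _ _ _ mphi.
pose phi' : {mfun (measurableTypeR R) >-> (measurableTypeR R)} := HB.pack phi mphi_mixin.
pose hn : {nonneg R} := NngNum (ltW h0).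
have E B : measurable B -> lambda B = mscale hn (pushforward lambda phi') B.
  move=> mB; apply: lebesgue_measure_unique => // _ [[a b] _ <-]/=.
  rewrite /mscale/= /pushforward.
  have -> : phi @^-1` `]a, b] = `](a - y) / h, (b - y) / h]%classic.
    apply/seteqP; split => u; rewrite /phi/= !in_itv/= ltr_pdivrMr// ler_pdivlMr//.
      by rewrite (mulrC h) ltrBlDl lerBrDl.
    by rewrite (mulrC h) ltrBlDl lerBrDl.
  rewrite !lebesgue_measure_itv/= !lte_fin ltr_pM2r ?invr_gt0// ltrD2r.
  case: ifPn => ab; last by rewrite mule0.
  by rewrite -!EFinD -EFinM; congr (_%:E); field; rewrite gt_eqF.
under [RHS]eq_integral do rewrite mulrC.
apply: (ge0_integral_density mphi (D := cst h)) => //.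
  by move=> x; exact: ltW.
move=> B mB; rewrite (integral_cst _ _ h%:E).
  exact: (E mphi).
by rewrite -[_ @^-1` _]setTI; exact: (mphi measurableT B mB).
Qed.

End affine.

(** * Two tools for double integrals *)

Section hoelder_geometric.
Context d (T : measurableType d) (R : realType) (mu : {measure set T -> \bar R}).

(** The Hoelder inequality with exponents [a^-1] and [(1 - a)^-1], in the form in
    which only bounds on the integrals of the two factors enter. *)
Lemma ge0_hoelder_powR (f g : T -> R) (a A B : R) :
  measurable_fun setT f -> measurable_fun setT g ->
  (forall x, 0 <= f x) -> (forall x, 0 <= g x) ->
  0 < a -> a < 1 ->
  (\int[mu]_x (f x)%:E <= A%:E)%E -> (\int[mu]_x (g x)%:E <= B%:E)%E ->
  (\int[mu]_x (f x `^ a * g x `^ (1 - a))%:E <= (A `^ a * B `^ (1 - a))%:E)%E.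
Proof.
move=> mf mg f0 g0 a0 a1 fA gB.
have b0 : 0 < 1 - a by rewrite subr_gt0.
have N (u : T -> R) (c C : R) : (forall x, 0 <= u x) -> 0 < c ->
    (\int[mu]_x (u x)%:E <= C%:E)%E ->
    ('N[mu]_(c^-1)%:E[EFin \o (fun x => u x `^ c)%R] <= (C `^ c)%:E)%E.
  move=> u0 c0 uC; rewrite unlock invrK.
  have -> : (\int[mu]_x `|(EFin \o (fun x => (u x `^ c)%R)) x| `^ c^-1 =
             \int[mu]_x (u x)%:E)%E.
    apply: eq_integral => x _ /=; rewrite ger0_norm ?powR_ge0//.
    by rewrite -powRrM divff ?gt_eqF// powRr1.
  have u_ge0 : (0 <= \int[mu]_x (u x)%:E)%E by apply: integral_ge0 => x _; rewrite lee_fin.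
  rewrite -poweR_EFin; apply: gt0_ler_poweR => //; first exact: ltW.
    by rewrite in_itv/= u_ge0 leey.
  by rewrite in_itv/= leey (le_trans u_ge0 uC).
have mF : measurable_fun setT (fun x => f x `^ a).
  exact: measurableT_comp (measurable_powR _) mf.
have mG : measurable_fun setT (fun x => g x `^ (1 - a)).
  exact: measurableT_comp (measurable_powR _) mg.
have := @hoelder _ _ _ mu _ _ a^-1 (1 - a)^-1 mF mG.
rewrite !invr_gt0 !invrK => /(_ a0 b0); rewrite subrKC => /(_ erefl).
rewrite Lnorm1.
rewrite (eq_integral (fun x => (f x `^ a * g x `^ (1 - a))%:E)); last first.
  by move=> x _ /=; rewrite ger0_norm// mulr_ge0// powR_ge0.
move=> /le_trans; apply.
by rewrite EFinM lee_pmul// ?Lnorm_ge0//; exact: N.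
Qed.

End hoelder_geometric.

Section integral_parameter.
Context d1 d2 (T1 : measurableType d1) (T2 : measurableType d2) (R : realType).
Variable P : {sigma_finite_measure set T1 -> \bar R}.

Lemma measurable_integral_parameter (F : T1 * T2 -> R) : measurable_fun setT F ->
  measurable_fun setT (fun x => \int[P]_w F (w, x)).
Proof.
move=> mF; have mF' : measurable_fun setT (EFin \o F) by exact/measurable_EFinP.
suff mI : measurable_fun setT (fun x => \int[P]_w (F (w, x))%:E)%E.
  exact: (measurableT_comp (fine_measurable measurableT) mI).
under eq_fun do rewrite integralE.
apply: emeasurable_funB.
  have mp : measurable_fun setT (funepos (EFin \o F)) by exact: measurable_funepos.
  rewrite (_ : (fun x => _) = fubini_G P (funepos (EFin \o F))).
    exact: (measurable_fun_fubini_tonelli_G _ mp (fun=> funepos_ge0 _ _)).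
  by apply/funext => x; apply: eq_integral => w _; rewrite !funeposE.
have mn : measurable_fun setT (funeneg (EFin \o F)) by exact: measurable_funeneg.
rewrite (_ : (fun x => _) = fubini_G P (funeneg (EFin \o F))).
  exact: (measurable_fun_fubini_tonelli_G _ mn (fun=> funeneg_ge0 _ _)).
by apply/funext => x; apply: eq_integral => w _; rewrite !funenegE.
Qed.

End integral_parameter.

(** * Functions of bounded variation *)

Section right_limits.
Context {R : realType}.
Implicit Types (K g : R -> R).

(** The open gaps between the value and the right limit at distinct jumps are
    disjoint, so rationals chosen in them are distinct. *)
Lemma countable_right_jump g M : nondecreasing g -> (forall x, `|g x| <= M) ->
  countable [set x | right_lim g x != g x].
Proof.
move=> nd gM.
have rat_between x : {q : rat | right_lim g x != g x -> g x < ratr q < right_lim g x}.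
  have [E|E] := eqVneq (right_lim g x) (g x); first by exists 0.
  apply: cid; have lt : g x < right_lim g x.
    by rewrite lt_neqAle eq_sym E (right_lim_ge x nd gM).
  by have [q] := rat_in_itvoo lt; rewrite in_itv/= => ?; exists q.
apply/countable_injP; exists (fun x => pickle (sval (rat_between x))).
suff lt_inj x y : right_lim g x != g x -> right_lim g y != g y -> x < y ->
    sval (rat_between x) = sval (rat_between y) -> False.
  move=> x y; rewrite !inE/= => Ax Ay /(pcan_inj pickleK) E.
  have [xy|yx|//] := ltgtP x y; first by case: (lt_inj x y).
  by case: (lt_inj y x).
move=> Ax Ay xy E.
case/andP: (svalP (rat_between x) Ax) => _ lx.
case/andP: (svalP (rat_between y) Ay) => ly _.
have lx' := eq_ind _ (fun q => ratr q < _) lx _ E.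
have := lt_trans ly (lt_le_trans lx' (right_lim_le nd gM xy)).
by rewrite ltxx.
Qed.

Lemma bounded_variationT_bounded K : bounded_variationT K ->
  exists M, forall x, `|K x| <= M.
Proof.
move=> /bounded_variationT_decomp[g1 [g2 [M [_ _ [b1 b2] ->]]]].
exists (M + M) => x; rewrite (le_trans (ler_normB _ _))//.
by rewrite lerD.
Qed.

Lemma countable_right_lim_neq K : bounded_variationT K ->
  countable [set x | right_lim K x != K x].
Proof.
move=> /bounded_variationT_decomp[g1 [g2 [M [nd1 nd2 [b1 b2] KE]]]].
have KlimE x : right_lim K x = right_lim g1 x - right_lim g2 x.
  apply/cvg_lim => //; rewrite KE.
  exact: cvgB (right_lim_nd nd1 b1) (right_lim_nd nd2 b2).
have jumps : countable (\bigcup_(b in [set: bool])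
    [set x | right_lim (if b then g1 else g2) x != (if b then g1 else g2) x]).
  apply: bigcup_countable => // -[_|_].
    exact: countable_right_jump nd1 b1.
  exact: countable_right_jump nd2 b2.
apply: sub_countable jumps; apply: subset_card_le => x /=; rewrite KlimE KE/=.
have [->|] := eqVneq (right_lim g1 x) (g1 x); last by exists true.
by have [->|] := eqVneq (right_lim g2 x) (g2 x); [rewrite eqxx|exists false].
Qed.

(** The defining property of dK only determines the increments of the right limit,
    hence the additive constant, which covariances do not see. *)
Lemma right_lim_stieltjes K (bvK : bounded_variationT K) :
  exists mp mn : {finite_measure set (measurableTypeR R) -> \bar R}, exists c,
  [/\ forall x, right_lim K x = c + fine (mp `]-oo, x]%classic) - fine (mn `]-oo, x]%classic)
     & charge_norm (stieltjes_charge bvK) = fine (mp setT) + fine (mn setT)].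
Proof.
set nu := stieltjes_charge bvK; rewrite /charge_norm.
case: cid => A exN /=; case: cid => B AB /=.
exists (jordan_pos AB), (jordan_neg AB).
exists (right_lim K 0 - fine (nu `]-oo, 0]%classic)); split; last first.
  by rewrite fineD// fin_num_measure.
have nuE x : fine (nu `]-oo, x]%classic) =
    fine (jordan_pos AB `]-oo, x]%classic) - fine (jordan_neg AB `]-oo, x]%classic).
  rewrite (jordan_decomp AB)// /cadd/= cscaleN1 fineB// ?fin_num_measure//.
have step a b : a <= b ->
    fine (nu `]-oo, b]%classic) - fine (nu `]-oo, a]%classic) = right_lim K b - right_lim K a.
  move=> ab.
  have -> : `]-oo, b]%classic = `]-oo, a]%classic `|` `]a, b]%classic.
    apply/seteqP; split => x /=; rewrite !in_itv/=.
      by move=> xb; have [xa|ax] := leP x a; [left|right].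
    by move=> [xa|/andP[]//]; exact: le_trans xa ab.
  rewrite chargeU//; last first.
    apply/seteqP; split => // x [] /=; rewrite !in_itv/=.
    by move=> /le_lt_trans xa /andP[/xa]; rewrite ltxx.
  by rewrite (stieltjes_chargeE bvK ab) fineD ?fin_num_measure//= addrC addKr.
move=> x; rewrite -addrA -nuE.
have [x0|x0] := leP 0 x; first by have := step _ _ x0; lra.
by have := step _ _ (ltW x0); lra.
Qed.

End right_limits.

(** * Bounded measurable functions *)

Section bounded_integral.
Context d (T : measurableType d) (R : realType).
Variable m : {finite_measure set T -> \bar R}.
Implicit Types u v : T -> R.

Definition bounded_measurable u :=
  measurable_fun setT u /\ exists M, forall w, `|u w| <= M.

Lemma bounded_measurable_cst c : bounded_measurable (fun=> c).
Proof. by split=> //; exists `|c|. Qed.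

Lemma bounded_measurableD u v : bounded_measurable u -> bounded_measurable v ->
  bounded_measurable (fun w => u w + v w).
Proof.
move=> [mu [M uM]] [mv [N vN]]; split; first exact: measurable_funD.
by exists (M + N) => w; rewrite (le_trans (ler_normD _ _))// lerD.
Qed.

Lemma bounded_measurableB u v : bounded_measurable u -> bounded_measurable v ->
  bounded_measurable (fun w => u w - v w).
Proof.
move=> [mu [M uM]] [mv [N vN]]; split; first exact: measurable_funB.
by exists (M + N) => w; rewrite (le_trans (ler_normB _ _))// lerD.
Qed.

Lemma bounded_measurableM u v : bounded_measurable u -> bounded_measurable v ->
  bounded_measurable (fun w => u w * v w).
Proof.
move=> [mu [M uM]] [mv [N vN]]; split; first exact: measurable_funM.
by exists (M * N) => w; rewrite normrM ler_pM.
Qed.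

Lemma bounded_measurable_norm u : bounded_measurable u ->
  bounded_measurable (fun w => `|u w|).
Proof.
move=> [mu [M uM]]; split; first exact: measurableT_comp.
by exists M => w; rewrite normr_id.
Qed.

Lemma bounded_measurable_le (f g : T -> R) :
  measurable_fun setT f -> measurable_fun setT g ->
  bounded_measurable (fun w => (f w <= g w)%R%:R).
Proof.
move=> mf mg; split; last by exists 1 => w; rewrite normr_nat lern1 leq_b1.
rewrite (_ : (fun w => _) = (fun w => if f w <= g w then 1 else 0)).
  by apply: measurable_fun_ifT => //; exact: measurable_fun_ler.
by apply/funext => w; case: (f w <= g w)%R.
Qed.

Lemma bounded_measurable_sum (I : Type) (s : seq I) (f : I -> T -> R) :
  (forall i, bounded_measurable (f i)) ->
  bounded_measurable (fun w => \sum_(i <- s) f i w).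
Proof.
move=> bf; elim: s => [|i s ih].
  by under eq_fun do rewrite big_nil; exact: bounded_measurable_cst.
by under eq_fun do rewrite big_cons; exact: bounded_measurableD.
Qed.

Lemma bounded_measurable_integrable u : bounded_measurable u ->
  m.-integrable setT (EFin \o u).
Proof.
move=> [mu [M uM]]; apply: measurable_bounded_integrable => //.
  by rewrite -ge0_fin_numE// fin_num_measure.
exists M; split; first exact: num_real.
by move=> N MN x _; exact: le_trans (uM x) (ltW MN).
Qed.

Lemma EFin_bounded_integral u : bounded_measurable u ->
  (\int[m]_w u w)%:E = (\int[m]_w (u w)%:E)%E.
Proof.
by move=> bu; rewrite fineK//; exact/integrable_fin_num/bounded_measurable_integrable.
Qed.

Lemma bounded_integralD u v : bounded_measurable u -> bounded_measurable v ->
  \int[m]_w (u w + v w) = \int[m]_w u w + \int[m]_w v w.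
Proof. by move=> bu bv; rewrite RintegralD//; exact: bounded_measurable_integrable. Qed.

Lemma bounded_integralB u v : bounded_measurable u -> bounded_measurable v ->
  \int[m]_w (u w - v w) = \int[m]_w u w - \int[m]_w v w.
Proof. by move=> bu bv; rewrite RintegralB//; exact: bounded_measurable_integrable. Qed.

Lemma bounded_integralZl u c : bounded_measurable u ->
  \int[m]_w (c * u w) = c * \int[m]_w u w.
Proof. by move=> bu; rewrite RintegralZl//; exact: bounded_measurable_integrable. Qed.

Lemma bounded_integral_sum (I : Type) (s : seq I) (f : I -> T -> R) :
  (forall i, bounded_measurable (f i)) ->
  \int[m]_w (\sum_(i <- s) f i w) = \sum_(i <- s) \int[m]_w f i w.
Proof.
move=> bf; elim: s => [|i s ih].
  rewrite big_nil; under eq_Rintegral do rewrite big_nil.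
  by rewrite Rintegral_cst// mul0r.
rewrite big_cons -ih; under eq_Rintegral do rewrite big_cons.
by rewrite bounded_integralD//; exact: bounded_measurable_sum.
Qed.

Lemma bounded_integral_cst c : \int[m]_w (fun=> c) w = c * fine (m setT).
Proof. exact: Rintegral_cst. Qed.

Lemma le_bounded_integral u v : bounded_measurable u -> bounded_measurable v ->
  (forall w, u w <= v w) -> \int[m]_w u w <= \int[m]_w v w.
Proof.
move=> bu bv uv; apply: le_Rintegral => //; exact: bounded_measurable_integrable.
Qed.

Lemma ler_norm_bounded_integral u v : bounded_measurable u -> bounded_measurable v ->
  (forall w, `|u w| <= v w) -> `|\int[m]_w u w| <= \int[m]_w v w.
Proof.
move=> bu bv uv; apply: (le_trans (le_normr_Rintegral _ _)) => //.
  exact: bounded_measurable_integrable.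
by apply: le_bounded_integral => //; exact: bounded_measurable_norm.
Qed.

End bounded_integral.

Lemma bounded_measurable_integral d1 d2 (T1 : measurableType d1)
    (T2 : measurableType d2) (R : realType)
    (m : {finite_measure set T1 -> \bar R}) (F : T1 * T2 -> R) :
  bounded_measurable F -> bounded_measurable (fun y => \int[m]_x F (x, y)).
Proof.
move=> [mF [M FM]]; split; first exact: measurable_integral_parameter.
exists (M * fine (m setT)) => y.
rewrite -bounded_integral_cst; apply: ler_norm_bounded_integral => //.
  split; last by exists M.
  exact: measurableT_comp mF (pair2_measurable y).
exact: bounded_measurable_cst.
Qed.

Section bounded_Fubini.
Context d1 d2 (T1 : measurableType d1) (T2 : measurableType d2) (R : realType).
Variables (m1 : {finite_measure set T1 -> \bar R}) (m2 : {finite_measure set T2 -> \bar R}).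
Variable F : T1 * T2 -> R.
Hypothesis bF : bounded_measurable F.

Let EFin_iterated G : bounded_measurable G ->
  (\int[m1]_x \int[m2]_y G (x, y))%:E = (\int[m1]_x \int[m2]_y (G (x, y))%:E)%E.
Proof.
move=> bG; rewrite EFin_bounded_integral.
  apply: eq_integral => x _; rewrite EFin_bounded_integral//.
  case: bG => mG [M GM]; split; last by exists M.
  exact: measurableT_comp mG (pair1_measurable x).
apply: (@bounded_measurable_integral _ _ _ _ _ m2 (fun p => G (p.2, p.1))).
case: bG => mG [M GM]; split; last by exists M => x; exact: GM.
apply: measurableT_comp mG _; exact: measurable_fun_pair measurable_snd measurable_fst.
Qed.

Lemma bounded_Fubini :
  \int[m1]_x \int[m2]_y F (x, y) = \int[m2]_y \int[m1]_x F (x, y).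
Proof.
have iF : (m1 \x m2)%E.-integrable setT (EFin \o F).
  apply/integrable12ltyP; first by apply/measurable_EFinP; case: bF.
  by rewrite -(EFin_iterated (bounded_measurable_norm bF)) ltry.
apply: EFin_inj; rewrite (EFin_iterated bF) (Fubini iF).
rewrite EFin_bounded_integral; last exact: bounded_measurable_integral.
apply: eq_integral => y _; rewrite EFin_bounded_integral//.
case: bF => mF [M FM]; split; last by exists M.
exact: measurableT_comp mF (pair2_measurable y).
Qed.

End bounded_Fubini.

(** * Covariances with distribution functions *)

Section covariance.
Context d (T : measurableType d) (R : realType) (P : probability T R).
Implicit Types u v z X : T -> R.

Definition cov u v := \int[P]_w (u w * v w) - (\int[P]_w u w) * \int[P]_w v w.

Lemma Rintegral_probability_cst c : \int[P]_w (fun=> c) w = c.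
Proof. by rewrite Rintegral_cst// -[X in fine X]/(P setT) probability_setT mulr1. Qed.

Lemma cov_cstDB z u v c : bounded_measurable z -> bounded_measurable u ->
  bounded_measurable v -> cov z (fun w => c + u w - v w) = cov z u - cov z v.
Proof.
move=> bz bu bv; rewrite /cov.
have bc : bounded_measurable (fun=> c : R) := @bounded_measurable_cst _ T R c.
rewrite (_ : \int[P]_w (z w * (c + u w - v w)) =
    \int[P]_w (c * z w + z w * u w - z w * v w)); last first.
  by apply: eq_Rintegral => w _; ring.
rewrite bounded_integralB//; first last.
- exact: bounded_measurableM.
- by apply: bounded_measurableD; exact: bounded_measurableM.
rewrite bounded_integralD//; first last.
- exact: bounded_measurableM.
- exact: bounded_measurableM.
rewrite bounded_integralZl// bounded_integralB//; last exact: bounded_measurableD.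
rewrite (bounded_integralD P bc bu) Rintegral_probability_cst; ring.
Qed.

Variables (z X : T -> R) (bz : bounded_measurable z) (mX : measurable_fun setT X).

(** A finite measure is a superposition of unit masses, so its distribution
    function is an average of indicators of half-lines, and a bound on the
    covariance with all such indicators passes to it. *)
Lemma cov_distribution_le (m : {finite_measure set (measurableTypeR R) -> \bar R})
    (x h B : R) : 0 < h ->
  (forall t, `|cov z (fun w => (X w <= t)%R%:R)| <= B) ->
  `|cov z (fun w => fine (m `]-oo, (h^-1 * (x - X w))]%classic))| <= fine (m setT) * B.
Proof.
move=> h0 zB.
pose I (p : T * measurableTypeR R) : R := (X p.1 <= x - h * p.2)%R%:R.
have bI : bounded_measurable I.
  apply: bounded_measurable_le; first exact: measurableT_comp mX measurable_fst.
  by apply: measurable_funB => //; exact: measurable_funM.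
have bzI : bounded_measurable (fun p => z p.1 * I p).
  apply: bounded_measurableM => //; case: bz => mz [M zM]; split; last by exists M.
  exact: measurableT_comp mz measurable_fst.
have Iw w : bounded_measurable (fun u : measurableTypeR R => I (w, u)).
  case: bI => mI [M IM]; split; last by exists M.
  exact: measurableT_comp mI (pair1_measurable w).
have LE w : fine (m `]-oo, (h^-1 * (x - X w))]%classic) = \int[m]_t I (w, t).
  rewrite -[LHS]/(fine _) -(setIT `]-oo, _]%classic) -integral_indic//.
  congr fine; apply: eq_integral => u _; congr (_%:E).
  rewrite indicE /I/= mem_setE in_itv/=; congr (nat_of_bool _)%:R.
  by rewrite ler_pdivlMl// lerBrDl lerBrDr addrC.
have zL : \int[P]_w (z w * fine (m `]-oo, (h^-1 * (x - X w))]%classic)) =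
    \int[m]_t \int[P]_w (z w * I (w, t)).
  rewrite -(bounded_Fubini P m bzI); apply: eq_Rintegral => w _.
  by rewrite LE -(bounded_integralZl m _ (Iw w)).
have L : \int[P]_w (fine (m `]-oo, (h^-1 * (x - X w))]%classic)) =
    \int[m]_t \int[P]_w (I (w, t)).
  rewrite -(bounded_Fubini P m bI); apply: eq_Rintegral => w _.
  by rewrite LE.
have bIu := bounded_measurable_integral P bI.
have bzIu := bounded_measurable_integral P bzI.
have bEI : bounded_measurable (fun t => (\int[P]_w z w) * \int[P]_w I (w, t)).
  by apply: bounded_measurableM => //; exact: bounded_measurable_cst.
rewrite /cov zL L -bounded_integralZl// -bounded_integralB//.
rewrite mulrC -bounded_integral_cst; apply: ler_norm_bounded_integral.
- exact: bounded_measurableB.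
- exact: bounded_measurable_cst.
- by move=> t; have := zB (x - h * t); rewrite /cov.
Qed.

End covariance.

(** * The Kolmogorov distance *)

Section halflines.
Context {R : realType}.
Implicit Types m : {measure set (measurableTypeR R) -> \bar R}.

Definition halfline_mass m (t : R) : R := fine (m `]-oo, t]%classic).

Lemma le_halfline_mass m s t : fin_num_fun m -> s <= t ->
  halfline_mass m s <= halfline_mass m t.
Proof.
move=> fm st; apply: fine_le; rewrite ?fm//.
by apply: le_measure; rewrite ?inE//; apply: subset_itvl.
Qed.

Lemma norm_halfline_mass_le m t : fin_num_fun m ->
  `|halfline_mass m t| <= fine (m setT).
Proof.
move=> fm; rewrite ger0_norm ?fine_ge0// fine_le ?fm//.
by apply: le_measure; rewrite ?inE.
Qed.

Lemma halfline_mass_right_continuous m t e : fin_num_fun m -> 0 < e ->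
  \forall n \near \oo, halfline_mass m (t + n.+1%:R^-1) <= halfline_mass m t + e.
Proof.
move=> fm e0.
have : m `]-oo, t + n.+1%:R^-1]%classic @[n --> \oo] --> m `]-oo, t]%classic.
  have -> : `]-oo, t]%classic = \bigcap_n `]-oo, t + n.+1%:R^-1]%classic.
    exact: (itvNycEbigcap false).
  apply: nonincreasing_cvg_mu => //.
  - by rewrite -ge0_fin_numE// fm.
  - exact: bigcap_measurable.
  - move=> a b ab; apply/subsetPset; apply: subset_itvl.
    by rewrite bnd_simp lerD2l lef_pV2 ?posrE// ler_nat.
rewrite -[m `]-oo, t]%classic]fineK ?fm// => /fine_cvgP[_] /cvgrPdist_le/(_ _ e0).
apply: filterS => n /=; rewrite distrC => /(le_trans (ler_norm _)).
by rewrite lerBlDl.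
Qed.

Definition rat_point (n : nat) : R := ratr (odflt 0 (unpickle n : option rat)).

Definition kolmogorov_dist m1 m2 : R :=
  sup [set `|halfline_mass m1 t - halfline_mass m2 t| | t in [set: R]].

(** Distribution functions are right-continuous, so the distance is a supremum
    along rationals; a countable supremum is what makes the dependence
    coefficients measurable. *)
Lemma kolmogorov_dist_rat m1 m2 : fin_num_fun m1 -> fin_num_fun m2 ->
  kolmogorov_dist m1 m2 =
  sups (fun n => `|halfline_mass m1 (rat_point n) - halfline_mass m2 (rat_point n)|) 0.
Proof.
move=> f1 f2; set D := fun t => `|halfline_mass m1 t - halfline_mass m2 t|.
have D_le t : D t <= fine (m1 setT) + fine (m2 setT).
  by rewrite (le_trans (ler_normB _ _))// lerD// norm_halfline_mass_le.
have ubr : has_ubound (range (D \o rat_point)).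
  by exists (fine (m1 setT) + fine (m2 setT)) => _ [n _ <-]; exact: D_le.
have -> : sups (fun n => D (rat_point n)) 0 = sup (range (D \o rat_point)).
  rewrite /sups/=; congr sup; apply/seteqP; split => _ [n _ <-]; by exists n.
apply/le_anti/andP; split.
  apply: ge_sup; first by exists (D 0), 0.
  move=> _ [t _ <-]; apply/ler_addgt0Pr => e e0; near \oo => n.
  have n0 : t < t + n.+1%:R^-1 by rewrite ltrDl.
  have [q] := rat_in_itvoo n0; rewrite in_itv/= => /andP[tq qn].
  (* A rational q just to the right of t: both masses at q exceed those at t by
     at most e, and so their difference moves by at most e. *)
  have [r rE] : exists r, rat_point r = ratr q.
    by exists (pickle q); rewrite /rat_point pickleK.
  apply: (@le_trans _ _ (D (ratr q) + e)); last first.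
    by rewrite lerD2r -rE; apply: ub_le_sup => //; exists r.
  have h1 := le_halfline_mass f1 (ltW tq); have h2 := le_halfline_mass f2 (ltW tq).
  have h1' := le_halfline_mass f1 (ltW qn); have h2' := le_halfline_mass f2 (ltW qn).
  have k1 : halfline_mass m1 (t + n.+1%:R^-1) <= halfline_mass m1 t + e.
    by near: n; exact: halfline_mass_right_continuous.
  have k2 : halfline_mass m2 (t + n.+1%:R^-1) <= halfline_mass m2 t + e.
    by near: n; exact: halfline_mass_right_continuous.
  rewrite /D.
  set a := halfline_mass m1 t in h1 k1 *; set b := halfline_mass m2 t in h2 k2 *.
  set a' := halfline_mass m1 (ratr q) in h1 h1' *.
  set b' := halfline_mass m2 (ratr q) in h2 h2' *.
  have : `|(a - b) - (a' - b')| <= e by rewrite ler_norml; apply/andP; split; lra.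
  by rewrite -lerBlDl => /(le_trans _); apply; rewrite lerB_dist.
apply: ge_sup; first by exists (D (rat_point 0)), 0%N.
move=> _ [n _ <-]; apply: ub_le_sup; last by exists (rat_point n).
by exists (fine (m1 setT) + fine (m2 setT)) => _ [t _ <-]; exact: D_le.
Unshelve. all: by end_near. Qed.

Lemma le_kolmogorov_dist m1 m2 t : fin_num_fun m1 -> fin_num_fun m2 ->
  `|halfline_mass m1 t - halfline_mass m2 t| <= kolmogorov_dist m1 m2.
Proof.
move=> f1 f2; apply: ub_le_sup; last by exists t.
exists (fine (m1 setT) + fine (m2 setT)) => _ [s _ <-].
by rewrite (le_trans (ler_normB _ _))// lerD// norm_halfline_mass_le.
Qed.

Lemma kolmogorov_dist_ge0 m1 m2 : fin_num_fun m1 -> fin_num_fun m2 ->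
  0 <= kolmogorov_dist m1 m2.
Proof. by move=> f1 f2; apply: le_trans (le_kolmogorov_dist 0 f1 f2). Qed.

Lemma kolmogorov_dist_le1 m1 m2 : fin_num_fun m1 -> fin_num_fun m2 ->
  m1 setT = 1%E -> m2 setT = 1%E -> kolmogorov_dist m1 m2 <= 1.
Proof.
move=> f1 f2 m1T m2T; apply: ge_sup.
  by exists `|halfline_mass m1 0 - halfline_mass m2 0|, 0.
move=> _ [t _ <-].
have G_le m : fin_num_fun m -> m setT = 1%E -> halfline_mass m t <= 1.
  move=> fm mT; rewrite -lee_fin fineK ?fm// -mT.
  by apply: le_measure; rewrite ?inE.
have := G_le _ f1 m1T; have := G_le _ f2 m2T.
have g1 : 0 <= halfline_mass m1 t by rewrite fine_ge0.
have g2 : 0 <= halfline_mass m2 t by rewrite fine_ge0.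
by rewrite ler_norml; lra.
Qed.

End halflines.

(** * Dependence coefficients *)

Section dependence.
Context d (T : measurableType d) (R : realType) (P : probability T R).
Variable Y : int -> {RV P >-> R}.
Variable Q : forall k l : int,
  R.-pker (g_sigma_algebraType (past Y l)) ~> (measurableTypeR R).

Lemma past_measurable l A : <<s past Y l >> A -> measurable A.
Proof.
apply: smallest_sub; first exact: sigma_algebra_measurable.
move=> B [i _] [C mC <-]; rewrite setTI -[_ @^-1` _]setTI.
exact: (measurable_funP (Y i)).
Qed.

Lemma past_preimage l i B : i <= l -> measurable B -> <<s past Y l >> (Y i @^-1` B).
Proof.
move=> il mB; apply: sub_sigma_algebra; exists i => //.
by exists B => //; rewrite setTI.
Qed.

Lemma cond_distribution_fin_num k l w : fin_num_fun (Q k l w).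
Proof.
move=> A mA; rewrite ge0_fin_numE//; apply: (@le_lt_trans _ _ (Q k l w setT)).
  by apply: le_measure; rewrite ?inE.
by rewrite prob_kernel ltry.
Qed.

Lemma bounded_measurable_cond_distribution k l B : measurable B ->
  bounded_measurable (fun w : T => fine (Q k l w B)).
Proof.
move=> mB; split; last first.
  exists 1 => w; rewrite ger0_norm ?fine_ge0//.
  rewrite -lee_fin fineK ?cond_distribution_fin_num// -(@prob_kernel _ _ _ _ _ (Q k l) w).
  by apply: le_measure; rewrite ?inE.
apply: (measurableT_comp (fine_measurable measurableT)).
move=> _ C mC; rewrite setTI.
have := measurable_kernel (Q k l) B mB measurableT C mC.
rewrite setTI; exact: past_measurable.
Qed.

Lemma measurable_Y k : measurable_fun setT (Y k : T -> measurableTypeR R).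
Proof. exact: (@measurable_funP _ _ _ _ _ (Y k)). Qed.

(** The law of [Y k], as a measure on the measurable space that carries the
    Lebesgue measure and the conditional laws. *)
Definition law (k : int) : {measure set (measurableTypeR R) -> \bar R}.
Proof.
refine (pushforward P (Y k : T -> measurableTypeR R)).
exact: measurable_Y.
Defined.

Lemma lawE k B : law k B = P (Y k @^-1` B).
Proof. by []. Qed.

Lemma law_fin_num k : fin_num_fun (law k).
Proof.
move=> B mB; rewrite lawE fin_num_measure// -[_ @^-1` _]setTI.
exact: (measurable_Y k measurableT mB).
Qed.

Lemma b_coefE l k w : b_coef Q l k w = kolmogorov_dist (Q k l w) (law 0).
Proof.
congr sup; apply/seteqP; split=> _ [t _ <-]; exists t => //;
  by rewrite /halfline_mass /Rintegral !integral_indic//= !setIT.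
Qed.

Lemma b_coef_ge0 l k w : 0 <= b_coef Q l k w.
Proof.
rewrite b_coefE kolmogorov_dist_ge0//; first exact: cond_distribution_fin_num.
exact: law_fin_num.
Qed.

Lemma b_coef_le1 l k w : b_coef Q l k w <= 1.
Proof.
rewrite b_coefE kolmogorov_dist_le1//; first exact: cond_distribution_fin_num.
- exact: law_fin_num.
- exact: prob_kernel.
- by rewrite lawE preimage_setT probability_setT.
Qed.

Lemma bounded_measurable_b_coef l k : bounded_measurable (b_coef Q l k).
Proof.
split; last by exists 1 => w; rewrite ger0_norm ?b_coef_ge0 ?b_coef_le1.
rewrite (_ : b_coef Q l k = fun w => sups (fun n =>
    `|halfline_mass (Q k l w) (rat_point n)
      - halfline_mass (law 0) (rat_point n)|) 0); last first.
  apply/funext => w; rewrite b_coefE kolmogorov_dist_rat//.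
    exact: cond_distribution_fin_num.
  exact: law_fin_num.
apply: (@measurable_fun_sups _ T R setT (fun n w => `|halfline_mass (Q k l w) (rat_point n)
      - halfline_mass (law 0) (rat_point n)|)).
  move=> w _; exists 1 => _ [n _ <-]; apply: le_trans (b_coef_le1 l k w).
  rewrite b_coefE; apply: le_kolmogorov_dist.
    exact: cond_distribution_fin_num.
  exact: law_fin_num.
move=> n; apply: measurableT_comp => //; apply: measurable_funB => //.
by case: (bounded_measurable_cond_distribution k l (measurable_itv `]-oo, rat_point n])).
Qed.

End dependence.

(** * Conditioning on the past *)

Section conditioning.
Context d (T : measurableType d) (R : realType) (P : probability T R).
Variable Y : int -> {RV P >-> R}.
Variable Q : forall k l : int,
  R.-pker (g_sigma_algebraType (past Y l)) ~> (measurableTypeR R).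
Hypothesis Q_cond : forall k l : int, is_cond_distribution k (Q k l).

Let measurable_preimage k B : measurable B -> measurable (Y k @^-1` B).
Proof. by move=> mB; rewrite -[_ @^-1` _]setTI; exact: (measurable_Y Y k measurableT mB). Qed.

Lemma bounded_measurable_comp k (g : measurableTypeR R -> R) : bounded_measurable g ->
  bounded_measurable (fun w => g (Y k w)).
Proof.
move=> [mg [M gM]]; split; last by exists M.
exact: measurableT_comp mg (measurable_Y Y k).
Qed.

(** Both sides integrate [g] against the measure [A |-> P (Y 0 in A, Y k in B)],
    which has density [1_B (Y k)] along [Y 0] by definition and density
    [Q k 0 w B] along [Y 0] by conditioning on the event [Y 0 in A]. *)
Let ge0_cond_expectation k (g : measurableTypeR R -> R) (B : set (measurableTypeR R)) :
  bounded_measurable g -> (forall x, 0 <= g x) -> measurable B ->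
  \int[P]_w (g (Y 0 w) * \1_B (Y k w)) = \int[P]_w (g (Y 0 w) * fine (Q k 0 w B)).
Proof.
move=> [mg _] g0 mB; have mYB := measurable_preimage k mB.
have [m mE] : exists m : {measure set (measurableTypeR R) -> \bar R},
    forall A, m A = P (Y 0 @^-1` A `&` Y k @^-1` B).
  unshelve eexists.
    refine (pushforward (mrestr P mYB) (Y 0 : T -> measurableTypeR R)).
    exact: measurable_Y.
  by [].
congr fine.
transitivity (\int[m]_x (g x)%:E)%E.
  apply/esym/(ge0_integral_density (measurable_Y Y 0) (D := fun w => \1_B (Y k w))) => //.
    by apply: measurableT_comp (measurable_Y Y k); exact: measurable_indic.
  move=> A mA; rewrite mE; have mYA := measurable_preimage 0 mA.
  by rewrite setIC -integral_indic.
have [mQ _] := bounded_measurable_cond_distribution Q k 0 mB.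
apply: (ge0_integral_density (measurable_Y Y 0)) => //.
move=> A mA; have pA : <<s past Y 0 >> (Y 0 @^-1` A) by exact: past_preimage.
rewrite mE -(Q_cond k pA mB).
by apply: eq_integral => w _; rewrite fineK// cond_distribution_fin_num.
Qed.

Lemma cond_expectation k (g : measurableTypeR R -> R) (B : set (measurableTypeR R)) :
  bounded_measurable g -> measurable B ->
  \int[P]_w (g (Y 0 w) * \1_B (Y k w)) = \int[P]_w (g (Y 0 w) * fine (Q k 0 w B)).
Proof.
move=> bg mB; case: (bg) => mg [M gM].
have bM : bounded_measurable (fun=> M : R) := @bounded_measurable_cst _ T R M.
have bM' : bounded_measurable (fun=> M : R) :=
  @bounded_measurable_cst _ (measurableTypeR R) R M.
have bgM := bounded_measurableD bg bM'.
have M0 : 0 <= M by exact: le_trans (gM 0).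
have bI : bounded_measurable (fun w => \1_B (Y k w) : R).
  split; last by exists 1 => w; rewrite indicE normr_nat lern1 leq_b1.
  by apply: measurableT_comp (measurable_Y Y k); exact: measurable_indic.
have bQ := bounded_measurable_cond_distribution Q k 0 mB.
have bgY := bounded_measurable_comp 0 bg.
(* Adding the bound M to g reduces the claim to nonnegative functions. *)
have shift (u : T -> R) : bounded_measurable u ->
    \int[P]_w (g (Y 0 w) * u w) =
    \int[P]_w ((g (Y 0 w) + M) * u w) - \int[P]_w (M * u w).
  move=> bu; rewrite -bounded_integralB; last 2 first.
  - by apply: bounded_measurableM => //; exact: bounded_measurableD.
  - exact: bounded_measurableM.
  by apply: eq_Rintegral => w _; ring.
rewrite shift// [RHS]shift//.
congr (_ - _).
  apply: (ge0_cond_expectation k bgM) => // x.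
  by have := gM x; rewrite ler_norml => /andP[+ _]; lra.
exact: (ge0_cond_expectation k bM').
Qed.

(** Conditioning replaces the indicator by the conditional distribution function
    at [t]; subtracting the mean leaves the deviation of the conditional law from
    the marginal one at [t], whose absolute value is at most [b_coef]. *)
Lemma cov_halfline_le k (g : measurableTypeR R -> R) t :
  (forall B, measurable B -> law Y k B = law Y 0 B) ->
  bounded_measurable g ->
  `|cov P (fun w => g (Y 0 w)) (fun w => (Y k w <= t)%R%:R)| <=
  \int[P]_w (`|g (Y 0 w)| * b_coef Q 0 k w).
Proof.
move=> lawk bg; have bgY := bounded_measurable_comp 0 bg.
have mt : measurable (`]-oo, t]%classic : set (measurableTypeR R)) by [].
have bQ := bounded_measurable_cond_distribution Q k 0 mt.
have IE w : (Y k w <= t)%R%:R = \1_`]-oo, t]%classic (Y k w) :> R.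
  by rewrite indicE mem_setE in_itv.
have GE : \int[P]_w (Y k w <= t)%R%:R = halfline_mass (law Y 0) t.
  under eq_Rintegral do rewrite IE.
  rewrite /halfline_mass -lawk// lawE -[Y k @^-1` _]setIT -integral_indic//.
  exact: measurable_preimage.
rewrite /cov GE.
under eq_Rintegral do rewrite IE.
rewrite cond_expectation// mulrC -bounded_integralZl// -bounded_integralB//; first last.
- by apply: bounded_measurableM => //; exact: bounded_measurable_cst.
- exact: bounded_measurableM.
apply: ler_norm_bounded_integral.
- apply: bounded_measurableB; first exact: bounded_measurableM.
  by apply: bounded_measurableM => //; exact: bounded_measurable_cst.
- apply: bounded_measurableM; first exact: bounded_measurable_norm.
  exact: bounded_measurable_b_coef.
move=> w; rewrite (mulrC (halfline_mass _ _)) -mulrBr normrM ler_wpM2l//.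
rewrite b_coefE; apply: le_kolmogorov_dist; first exact: cond_distribution_fin_num.
exact: law_fin_num.
Qed.

End conditioning.

(** * Consequences of stationarity *)

Section stationarity.
Context d (T : measurableType d) (R : realType) (P : probability T R).
Variable Y : int -> {RV P >-> R}.
Hypothesis Y_stationary : strictly_stationary Y.

Lemma stationary_law k B : measurable B -> law Y k B = law Y 0 B.
Proof.
move=> mB; rewrite !lawE -[in LHS](add0r k).
have cB : <<s @cylinder R >> ((fun y : int -> R => y 0) @^-1` B).
  by apply: sub_sigma_algebra; exists 0 => //; exists B.
exact: (Y_stationary k cB).
Qed.

(** The pairs at times [(i, j)] and [(i + m, j + m)] have the same law, since the
    preimage of a measurable subset of the plane under two coordinates lies in the
    product sigma-algebra. *)
Lemma stationary_pair (F : R * R -> R) i j m : bounded_measurable F ->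
  \int[P]_w F (Y (i + m) w, Y (j + m) w) = \int[P]_w F (Y i w, Y j w).
Proof.
move=> bF; have [mF _] := bF.
have mp i' j' : measurable_fun setT (fun w => (Y i' w, Y j' w)).
  by apply: measurable_fun_pair.
have E i' j' : (\int[P]_w (F (Y i' w, Y j' w))%:E =
    \int[pushforward P (fun w => (Y i' w, Y j' w))]_p (F p)%:E)%E.
  rewrite integral_pushforward//; first exact/measurable_EFinP.
  apply: bounded_measurable_integrable; case: bF => _ [M FM].
  split; last by exists M.
  exact: measurableT_comp mF (mp _ _).
congr fine; rewrite !E.
apply: eq_measure_integral => C mC _.
rewrite /pushforward.
have cC : <<s @cylinder R >> ((fun y : int -> R => (y i, y j)) @^-1` C).
  have m_ k : measurable_fun setT (fun y : g_sigma_algebraType (@cylinder R) => y k : R).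
    move=> _ B mB; rewrite setTI; apply: sub_sigma_algebra.
    by exists k => //; exists B.
  have := measurable_fun_pair (m_ i) (m_ j) measurableT mC.
  by rewrite setTI.
exact: (Y_stationary m cC).
Qed.

End stationarity.

(** * Covariances of the kernel *)

Section kernel_covariance.
Context d (T : measurableType d) (R : realType) (P : probability T R).
Variable Y : int -> {RV P >-> R}.
Variable Q : forall k l : int,
  R.-pker (g_sigma_algebraType (past Y l)) ~> (measurableTypeR R).
Variables f K : R -> R.
Hypothesis Y_stationary : strictly_stationary Y.
Hypothesis f_density : is_density Y f.
Hypothesis Q_cond : forall k l : int, is_cond_distribution k (Q k l).
Hypothesis K_measurable : measurable_fun setT K.
Hypothesis K_bv : bounded_variationT K.

Lemma law_countable0 k (B : set R) : countable B -> P (Y k @^-1` B) = 0%E.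
Proof.
move=> cB.
have mB : measurable B by apply: countable_measurable => // t; exact: measurable_set1.
rewrite -lawE stationary_law//; case: f_density => mf f0 fE.
have := fE B mB; rewrite null_set_integral//.
  apply/measurable_EFinP; exact: measurable_funTS.
exact: countable_lebesgue_measure0.
Qed.

Let shift_K x h : measurable_fun setT (fun y : measurableTypeR R => K (h^-1 * (x - y))).
Proof.
apply: measurableT_comp K_measurable _; apply: measurable_funM => //.
exact: measurable_funB.
Qed.

Lemma bounded_measurable_shift x h :
  bounded_measurable (fun y : measurableTypeR R => K (h^-1 * (x - y))).
Proof.
split; first exact: shift_K.
by have [M KM] := bounded_variationT_bounded K_bv; exists M.
Qed.

(** The two Jordan parts of dK contribute their masses separately by
    [cov_distribution_le], and the masses add up to [||dK||]. *)
Lemma cov_kernel_le (g : measurableTypeR R -> R) k x h : 0 < h ->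
  bounded_measurable g ->
  `|cov P (fun w => g (Y 0 w)) (fun w => K (h^-1 * (x - Y k w)))| <=
  charge_norm (stieltjes_charge K_bv) * \int[P]_w (`|g (Y 0 w)| * b_coef Q 0 k w).
Proof.
move=> h0 bg; have [mp [mn [c [LE ->]]]] := right_lim_stieltjes K_bv.
set B := \int[P]_w (`|g (Y 0 w)| * b_coef Q 0 k w).
pose H (m : {finite_measure set (measurableTypeR R) -> \bar R}) w : R :=
  fine (m `]-oo, h^-1 * (x - Y k w)]%classic).
have bgY := bounded_measurable_comp Y 0 bg.
have bH m : bounded_measurable (H m).
  split; last first.
    exists (fine (m setT)) => w; rewrite ger0_norm ?fine_ge0//.
    apply: fine_le; rewrite ?fin_num_measure//.
    by apply: le_measure; rewrite ?inE.
  have nd : nondecreasing (fun t => fine (m `]-oo, t]%classic)).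
    by move=> s t st; apply: le_halfline_mass => // A mA; rewrite fin_num_measure.
  apply: (measurableT_comp (nondecreasing_measurable _ nd)) => //.
  apply: measurable_funM => //; exact: measurable_funB.
have bKY := bounded_measurable_comp Y k (bounded_measurable_shift x h).
have covKL : cov P (fun w => g (Y 0 w)) (fun w => K (h^-1 * (x - Y k w))) =
    cov P (fun w => g (Y 0 w)) (fun w => c + H mp w - H mn w).
  have bL : bounded_measurable (fun w => c + H mp w - H mn w).
    apply: bounded_measurableB => //; apply: bounded_measurableD => //.
    exact: bounded_measurable_cst.
  (* The points where K differs from its right limit are countably many, so they
     are reached with probability zero. *)
  have aeKL : {ae P, forall w, K (h^-1 * (x - Y k w)) = c + H mp w - H mn w}.
    exists (Y k @^-1` [set y | right_lim K (h^-1 * (x - y)) != K (h^-1 * (x - y))]).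
    have cN : countable [set y | right_lim K (h^-1 * (x - y)) != K (h^-1 * (x - y))].
      have /countable_injP[e e_inj] := countable_right_lim_neq K_bv.
      apply/countable_injP; exists (fun y => e (h^-1 * (x - y))) => y y'.
      rewrite !inE/= => Ny Ny' /(e_inj _ _ _ _); rewrite !inE => /(_ Ny Ny').
      by move=> /(mulfI (invr_neq0 (lt0r_neq0 h0)))/addrI/oppr_inj.
    split.
    - rewrite -[_ @^-1` _]setTI; apply: (measurable_Y Y k) => //.
      apply: countable_measurable cN => t; exact: measurable_set1.
    - exact: law_countable0.
    - by move=> w /= KL; rewrite LE; apply: contra_notN KL => /eqP <-.
  have eqint u v : bounded_measurable u -> bounded_measurable v ->
      {ae P, forall w, u w = v w} -> \int[P]_w u w = \int[P]_w v w.
    move=> [mu _] [mv _] uv; congr fine; apply: ae_eq_integral => //.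
    - exact/measurable_EFinP.
    - exact/measurable_EFinP.
    - by apply: filterS uv => w uvw _; rewrite uvw.
  rewrite /cov; congr (_ - _ * _); apply: eqint => //.
  - exact: bounded_measurableM.
  - exact: bounded_measurableM.
  - by apply: filterS aeKL => w ->.
have Hle m : `|cov P (fun w => g (Y 0 w)) (H m)| <= fine (m setT) * B.
  apply: cov_distribution_le => // t; apply: cov_halfline_le => //.
  exact: stationary_law.
by rewrite covKL cov_cstDB// (le_trans (ler_normB _ _))// mulrDl lerD.
Qed.

End kernel_covariance.

(** * Variance of the estimator *)

Section variance.
Context d (T : measurableType d) (R : realType) (P : probability T R).

(** Adding the summand of index [n + 1] creates its square and twice its
    products with the earlier ones, whose lags [1, ..., n] are distinct: each step
    costs at most [2 * \sum_j a j]. The bound [N] keeps this cost constant along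
    the induction on [n]. *)
Lemma integral_sqr_sum_le (X : nat -> T -> R) (a : nat -> R) (n N : nat) :
  (forall k, bounded_measurable (X k)) -> (forall j, 0 <= a j) ->
  (forall k l, (k <= l)%N -> `|\int[P]_w (X k w * X l w)| <= a (l - k)%N) ->
  (n <= N)%N ->
  \int[P]_w (\sum_(1 <= k < n.+1) X k w) ^+ 2 <= 2 * n%:R * \sum_(0 <= j < N.+1) a j.
Proof.
move=> bX a0 Xa; elim: n => [|n ih] nN.
  under eq_Rintegral do rewrite big_nil expr0n/=.
  by rewrite Rintegral_probability_cst mulr0 mul0r.
have bS : bounded_measurable (fun w => \sum_(1 <= k < n.+1) X k w).
  exact: bounded_measurable_sum.
have bSX : bounded_measurable (fun w => \sum_(1 <= k < n.+1) (X k w * X n.+1 w)).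
  by apply: bounded_measurable_sum => k; exact: bounded_measurableM.
have bSS := bounded_measurableM bS bS.
have bXX := bounded_measurableM (bX n.+1) (bX n.+1).
have b2 : bounded_measurable (fun=> 2 : R) := @bounded_measurable_cst _ T R 2.
have -> : \int[P]_w (\sum_(1 <= k < n.+2) X k w) ^+ 2 =
    \int[P]_w (\sum_(1 <= k < n.+1) X k w) ^+ 2
    + 2 * \sum_(1 <= k < n.+1) \int[P]_w (X k w * X n.+1 w)
    + \int[P]_w (X n.+1 w * X n.+1 w).
  rewrite -bounded_integral_sum; last by move=> k; exact: bounded_measurableM.
  rewrite -bounded_integralZl//.
  under [X in _ = X + _ + _]eq_Rintegral do rewrite expr2.
  rewrite -bounded_integralD//; last exact: bounded_measurableM.
  rewrite -bounded_integralD//; last first.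
    by apply: bounded_measurableD => //; exact: bounded_measurableM.
  apply: eq_Rintegral => w _; rewrite big_nat_recr//= -mulr_suml; ring.
have cross : \sum_(1 <= k < n.+1) \int[P]_w (X k w * X n.+1 w) <=
    \sum_(1 <= j < n.+1) a j.
  rewrite [leRHS]big_nat_rev/=; apply: ler_sum_nat => k /andP[k1 kn].
  by rewrite (le_trans (ler_norm _))// (le_trans (Xa _ _ _))// ?(ltnW kn)// add1n subSS.
have diag : \int[P]_w (X n.+1 w * X n.+1 w) <= a 0%N.
  by rewrite (le_trans (ler_norm _))// (le_trans (Xa _ _ _))// subnn.
have tot : \sum_(1 <= j < n.+1) a j + a 0%N <= \sum_(0 <= j < N.+1) a j.
  rewrite (@big_cat_nat _ _ _ n.+1 0 N.+1)//=; last exact: ltnW.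
  rewrite [in leRHS]big_ltn// (addrC (a 0%N)) lerDl.
  by apply: sumr_ge0.
have := ih (ltnW nN); have := a0 0%N; rewrite -(natr1 n) mulrDr mulr1 mulrDl.
move: cross diag tot; lra.
Qed.

End variance.

Lemma integral_centered_prod d (T : measurableType d) (R : realType)
    (P : probability T R) (u v : T -> R) :
  bounded_measurable u -> bounded_measurable v ->
  \int[P]_w ((u w - \int[P]_w' u w') * (v w - \int[P]_w' v w')) = cov P u v.
Proof.
move=> bu bv; set a := \int[P]_w' u w'; set b := \int[P]_w' v w'.
have bc (c : R) : bounded_measurable (fun=> c : R) := @bounded_measurable_cst _ T R c.
have buv := bounded_measurableM bu bv.
have bau := bounded_measurableM (bc b) bu; have bav := bounded_measurableM (bc a) bv.
rewrite (_ : \int[P]_w _ = \int[P]_w (u w * v w - b * u w - (a * v w - a * b))); last first.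
  by apply: eq_Rintegral => w _; ring.
rewrite bounded_integralB//; try exact: bounded_measurableB.
rewrite bounded_integralB// bounded_integralB//.
rewrite !bounded_integralZl// Rintegral_probability_cst -/a -/b /cov -/a -/b; ring.
Qed.

Section weighted_variance.
Context d (T : measurableType d) (R : realType) (P : probability T R).
Variable Y : int -> {RV P >-> R}.
Variable Q : forall k l : int,
  R.-pker (g_sigma_algebraType (past Y l)) ~> (measurableTypeR R).
Variables f K : R -> R.
Variable h : nat -> R.
Hypothesis Y_stationary : strictly_stationary Y.
Hypothesis f_density : is_density Y f.
Hypothesis Q_cond : forall k l : int, is_cond_distribution k (Q k l).
Hypothesis K_measurable : measurable_fun setT K.
Hypothesis K_bv : bounded_variationT K.
Hypothesis h_gt0 : forall n, (0 < n)%N -> 0 < h n.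

Local Notation lambda := (@lebesgue_measure R).

Definition centered_estimator n w x : R :=
  density_estimator Y K h n w x - fine 'E_P[fun w' => density_estimator Y K h n w' x].

Definition b_sum n w : R := \sum_(0 <= j < n.+1) b_coef Q 0 j%:Z w.

Lemma b_sum_ge0 n w : 0 <= b_sum n w.
Proof. by apply: sumr_ge0 => j _; exact: b_coef_ge0. Qed.

Lemma bounded_measurable_b_sum n : bounded_measurable (b_sum n).
Proof. by apply: bounded_measurable_sum => j; exact: bounded_measurable_b_coef. Qed.

Let G n x (k : int) w : R := K ((h n)^-1 * (x - Y k w)).

Let bG n x k : bounded_measurable (G n x k).
Proof.
exact: (bounded_measurable_comp Y k
  (bounded_measurable_shift K_measurable K_bv x (h n))).
Qed.

Lemma centered_estimatorE n w x : centered_estimator n w x =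
  (n%:R * h n)^-1 * \sum_(1 <= k < n.+1) (G n x k%:Z w - \int[P]_w' G n x k%:Z w').
Proof.
have -> : \sum_(1 <= k < n.+1) (G n x k%:Z w - \int[P]_w' G n x k%:Z w') =
    \sum_(1 <= k < n.+1) G n x k%:Z w - \int[P]_w' \sum_(1 <= k < n.+1) G n x k%:Z w'.
  by rewrite sumrB bounded_integral_sum// => k; exact: bG.
rewrite /centered_estimator mulrBr unlock; congr (_ - _).
by rewrite -bounded_integralZl//; apply: bounded_measurable_sum => k; exact: bG.
Qed.

Lemma cov_shift n x (k l : nat) : (k <= l)%N ->
  cov P (G n x k%:Z) (G n x l%:Z) = cov P (G n x 0) (G n x (l - k)%N%:Z).
Proof.
move=> kl; pose g := fun y : R => K ((h n)^-1 * (x - y)).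
have [mg [M gM]] := bounded_measurable_shift K_measurable K_bv x (h n).
have mg' : measurable_fun setT (g : R -> R).
  apply: measurableT_comp K_measurable _; apply: measurable_funM => //.
  exact: measurable_funB.
have b1 : bounded_measurable (fun p : R * R => g p.1).
  by split; [exact: measurableT_comp mg' measurable_fst|exists M => p; exact: gM].
have b2 : bounded_measurable (fun p : R * R => g p.2).
  by split; [exact: measurableT_comp mg' measurable_snd|exists M => p; exact: gM].
have kE : k%:Z = 0 + k%:Z by rewrite add0r.
have lE : l%:Z = (l - k)%N%:Z + k%:Z by rewrite -PoszD subnK.
rewrite /cov {1}kE lE.
rewrite (stationary_pair Y_stationary 0 (l - k)%N%:Z k%:Z (bounded_measurableM b1 b2)).
by rewrite kE -lE (stationary_pair Y_stationary 0 0 k%:Z b1) lE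
  (stationary_pair Y_stationary 0 (l - k)%N%:Z k%:Z b2).
Qed.

Let dK := charge_norm (stieltjes_charge K_bv).

(** Lag [j] contributes [cov_kernel_le] with [G n x 0] as the bounded function of
    [Y 0]. This factor is kept inside the expectation: its integral in [x], taken
    later, supplies a factor [h n], so that one power of [h n] cancels. *)
Lemma variance_le n x : (0 < n)%N ->
  \int[P]_w (centered_estimator n w x) ^+ 2 <=
  2 * dK / (n%:R * h n ^+ 2) * \int[P]_w (`|G n x 0 w| * b_sum n w).
Proof.
move=> n0; have hn := h_gt0 n0.
pose X k w := G n x k%:Z w - \int[P]_w' G n x k%:Z w'.
have bX k : bounded_measurable (X k).
  by apply: bounded_measurableB; [exact: bG|exact: bounded_measurable_cst].
pose a j := dK * \int[P]_w (`|G n x 0 w| * b_coef Q 0 j%:Z w).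
have Xa k l : (k <= l)%N -> `|\int[P]_w (X k w * X l w)| <= a (l - k)%N.
  move=> kl; rewrite integral_centered_prod; [|exact: bG|exact: bG].
  rewrite cov_shift//.
  have bg := bounded_measurable_shift K_measurable K_bv x (h n).
  exact: (cov_kernel_le Y_stationary f_density Q_cond K_measurable K_bv _ _ hn bg).
have a0 j : 0 <= a j.
  by have := Xa 0%N j (leq0n _); rewrite subn0; apply: le_trans.
have := integral_sqr_sum_le bX a0 Xa (leqnn n).
have bS : bounded_measurable (fun w => \sum_(1 <= k < n.+1) X k w).
  exact: bounded_measurable_sum.
under eq_Rintegral do rewrite expr2.
under [X in _ -> X <= _]eq_Rintegral do rewrite centered_estimatorE expr2 mulrACA.
rewrite bounded_integralZl; last exact: (bounded_measurableM bS bS).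
have -> : \sum_(0 <= j < n.+1) a j = dK * \int[P]_w (`|G n x 0 w| * b_sum n w).
  rewrite -mulr_sumr -bounded_integral_sum; last first.
    move=> j; apply: bounded_measurableM; first exact/bounded_measurable_norm/bG.
    exact: bounded_measurable_b_coef.
  by congr (_ * _); apply: eq_Rintegral => w _; rewrite mulr_sumr.
set I := \int[P]_w (_ * _); set J := \int[P]_w _ => IJ.
have c0 : 0 <= (n%:R * h n)^-1 * (n%:R * h n)^-1.
  by rewrite mulr_ge0// invr_ge0 mulr_ge0// ltW.
apply: (le_trans (ler_wpM2l c0 IJ)); rewrite le_eqVlt; apply/orP; left; apply/eqP.
by field; rewrite pnatr_eq0 -lt0n n0 gt_eqF.
Qed.

Lemma charge_norm_ge0 : 0 <= dK.
Proof.
rewrite /dK; have [mp [mn [c [_ ->]]]] := right_lim_stieltjes K_bv.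
by rewrite addr_ge0// fine_ge0.
Qed.

Let mG n k : measurable_fun setT
  (fun p : T * measurableTypeR R => G n p.2 k p.1).
Proof.
apply: measurableT_comp K_measurable _; apply: measurable_funM => //.
by apply: measurable_funB => //; exact: measurableT_comp (measurable_Y Y k) measurable_fst.
Qed.

Lemma measurable_centered_estimator n : measurable_fun setT
  (fun p : T * measurableTypeR R => centered_estimator n p.1 p.2).
Proof.
under eq_fun do rewrite centered_estimatorE.
apply: measurable_funM => //; apply: measurable_sum => k.
apply: measurable_funB; first exact: mG.
have mI := measurable_integral_parameter P (mG n k%:Z).
exact: measurableT_comp mI measurable_snd.
Qed.

Lemma bounded_measurable_centered_estimator n x :
  bounded_measurable (fun w => centered_estimator n w x).
Proof.
rewrite (_ : (fun w => _) = fun w => (n%:R * h n)^-1 *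
    \sum_(1 <= k < n.+1) (G n x k%:Z w - \int[P]_w' G n x k%:Z w')); last first.
  by apply/funext => w; rewrite centered_estimatorE.
apply: bounded_measurableM; first exact: bounded_measurable_cst.
apply: bounded_measurable_sum => k; apply: bounded_measurableB; first exact: bG.
exact: bounded_measurable_cst.
Qed.

(** Tonelli's theorem moves the integral in [x] inside the expectation, where for
    fixed [w] it meets [|G n x 0 w|] only. The weight and its bound [Phi] are left
    free: both risk bounds are instances. *)
Lemma weighted_variance_le (om Phi : measurableTypeR R -> R) n : (0 < n)%N ->
  measurable_fun setT om -> (forall x, 0 <= om x) ->
  measurable_fun setT Phi -> (forall x, 0 <= Phi x) ->
  (forall y, (\int[lambda]_x (om x * `|K ((h n)^-1 * (x - y))|)%:E <= (Phi y)%:E)%E) ->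
  (\int[P]_w \int[lambda]_x (om x * centered_estimator n w x ^+ 2)%:E <=
   (2 * dK / (n%:R * h n ^+ 2))%:E * \int[P]_w (Phi (Y 0 w) * b_sum n w)%:E)%E.
Proof.
move=> n0 mom om0 mPhi Phi0 omPhi; have hn := h_gt0 n0.
set C := 2 * dK / (n%:R * h n ^+ 2).
have C0 : 0 <= C.
  apply: divr_ge0; first by rewrite mulr_ge0// charge_norm_ge0.
  by rewrite mulr_ge0// exprn_ge0// ltW.
have mom2 : measurable_fun setT (fun p : T * measurableTypeR R => om p.2).
  exact: measurableT_comp mom measurable_snd.
have msq : measurable_fun setT (fun p : T * measurableTypeR R =>
    (om p.2 * centered_estimator n p.1 p.2 ^+ 2)%:E).
  apply/measurable_EFinP; apply: measurable_funM => //.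
  by apply: measurable_funX; exact: measurable_centered_estimator.
have mb : measurable_fun setT (fun p : T * measurableTypeR R => b_sum n p.1).
  by case: (bounded_measurable_b_sum n) => mb _; exact: measurableT_comp mb measurable_fst.
have mGb : measurable_fun setT (fun p : T * measurableTypeR R =>
    (om p.2 * (`|G n p.2 0 p.1| * b_sum n p.1))%:E).
  apply/measurable_EFinP; apply: measurable_funM => //; apply: measurable_funM => //.
  exact: measurableT_comp (mG n 0).
rewrite (fubini_tonelli (m1 := P) (m2 := lambda) (fun p =>
    (om p.2 * centered_estimator n p.1 p.2 ^+ 2)%:E))//=; last first.
  by move=> p; rewrite lee_fin mulr_ge0// sqr_ge0.
have inner x : (\int[P]_w (om x * centered_estimator n w x ^+ 2)%:E <=
    C%:E * \int[P]_w (om x * (`|G n x 0 w| * b_sum n w))%:E)%E.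
  have bc2 : bounded_measurable (fun w => centered_estimator n w x ^+ 2).
    under eq_fun do rewrite expr2.
    by apply: bounded_measurableM; exact: bounded_measurable_centered_estimator.
  have bGb : bounded_measurable (fun w => `|G n x 0 w| * b_sum n w).
    apply: bounded_measurableM; first exact/bounded_measurable_norm/bG.
    exact: bounded_measurable_b_sum.
  have bom : bounded_measurable (fun=> om x : R) := @bounded_measurable_cst _ T R (om x).
  rewrite -!EFin_bounded_integral; last 2 first.
  - exact: bounded_measurableM.
  - exact: bounded_measurableM.
  rewrite !bounded_integralZl// -EFinM lee_fin mulrCA ler_wpM2l//.
  exact: variance_le.
have mGsq : measurable_fun setT
    (fun x : measurableTypeR R => (\int[P]_w (om x * centered_estimator n w x ^+ 2)%:E)%E).
  apply: (measurable_fun_fubini_tonelli_G (m1 := P) (fun p : T * measurableTypeR R =>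
    (om p.2 * centered_estimator n p.1 p.2 ^+ 2)%:E)) => // p.
  by rewrite lee_fin mulr_ge0// sqr_ge0.
have mGGb : measurable_fun setT
    (fun x : measurableTypeR R => (\int[P]_w (om x * (`|G n x 0 w| * b_sum n w))%:E)%E).
  apply: (measurable_fun_fubini_tonelli_G (m1 := P) (fun p : T * measurableTypeR R =>
    (om p.2 * (`|G n p.2 0 p.1| * b_sum n p.1))%:E)) => // p.
  by rewrite lee_fin !mulr_ge0// b_sum_ge0.
have Gb_ge0 x : (0 <= \int[P]_w (om x * (`|G n x 0 w| * b_sum n w))%:E)%E.
  by apply: integral_ge0 => w _; rewrite lee_fin !mulr_ge0// b_sum_ge0.
apply: (@le_trans _ _ (\int[lambda]_x
    (C%:E * \int[P]_w (om x * (`|G n x 0 w| * b_sum n w))%:E))%E).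
  apply: ge0_le_integral => //.
    by move=> x _; apply: integral_ge0 => w _; rewrite lee_fin mulr_ge0// sqr_ge0.
  exact: emeasurable_funM.
rewrite ge0_integralZl_EFin//.
apply: lee_wpmul2l; first by rewrite lee_fin.
rewrite -(fubini_tonelli (m1 := P) (m2 := lambda) (fun p =>
    (om p.2 * (`|G n p.2 0 p.1| * b_sum n p.1))%:E))//=; last first.
  by move=> p; rewrite lee_fin !mulr_ge0// b_sum_ge0.
apply: ge0_le_integral => //.
- by move=> w _; apply: integral_ge0 => x _; rewrite lee_fin !mulr_ge0// b_sum_ge0.
- apply: (measurable_fun_fubini_tonelli_F (m2 := lambda) (fun p : T * measurableTypeR R =>
    (om p.2 * (`|G n p.2 0 p.1| * b_sum n p.1))%:E)) => // p.
  by rewrite lee_fin !mulr_ge0// b_sum_ge0.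
- apply/measurable_EFinP; apply: measurable_funM.
    exact: measurableT_comp mPhi (measurable_Y Y 0).
  by case: (bounded_measurable_b_sum n).
move=> w _.
have mGw : measurable_fun setT (fun x : measurableTypeR R => `|G n x 0 w|).
  apply: measurableT_comp (measurableT_comp (mG n 0) (pair1_measurable w)) => //.
under eq_integral do rewrite mulrA mulrC EFinM.
rewrite ge0_integralZl_EFin ?b_sum_ge0//; last 2 first.
- by move=> x _; rewrite lee_fin mulr_ge0.
- by apply/measurable_EFinP; exact: measurable_funM.
rewrite (mulrC (Phi _)) EFinM; apply: lee_wpmul2l; first by rewrite lee_fin b_sum_ge0.
exact: omPhi.
Qed.

End weighted_variance.

(** * Inequalities for real powers *)

Section power_inequalities.
Context {R : realType}.
Implicit Types (a b c s r : R).

(** The sum is at most three times the largest term. Unlike convexity, this works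
    for every exponent [s >= 0], below or above one. *)
Lemma powR_add3_le a b c s : 0 <= a -> 0 <= b -> 0 <= c -> 0 <= s ->
  (a + b + c) `^ s <= 3 `^ s * (a `^ s + b `^ s + c `^ s).
Proof.
move=> a0 b0 c0 s0.
have pa := powR_ge0 a s; have pb := powR_ge0 b s; have pc := powR_ge0 c s.
have le_max m : 0 <= m -> a <= m -> b <= m -> c <= m ->
    m `^ s <= a `^ s + b `^ s + c `^ s ->
    (a + b + c) `^ s <= 3 `^ s * (a `^ s + b `^ s + c `^ s).
  move=> m0 am bm cm ms; apply: (@le_trans _ _ ((3 * m) `^ s)).
    by apply: ge0_ler_powR => //; rewrite ?nnegrE; lra.
  by rewrite powRM// ler_wpM2l// powR_ge0.
have [ab|/ltW ba] := leP a b.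
  have [bc|/ltW cb] := leP b c; first by apply: (le_max c) => //; lra.
  by apply: (le_max b) => //; lra.
have [ac|/ltW ca] := leP a c; first by apply: (le_max c) => //; lra.
by apply: (le_max a) => //; lra.
Qed.

(** Tangent line inequality for [t `^ r] at [S + b], read off from Young's
    inequality for the product of [S] and [(S + b) `^ (r - 1)]. *)
Lemma powR_addr_le r S b : 1 < r -> 0 <= S -> 0 <= b ->
  (S + b) `^ r <= S `^ r + r * ((S + b) `^ (r - 1) * b).
Proof.
move=> r1 S0 b0; have r0 : 0 < r by exact: lt_trans r1.
have r10 : 0 < r - 1 by rewrite subr_gt0.
set V := S + b; have V0 : 0 <= V by rewrite addr_ge0.
have q0 : 0 < r / (r - 1) by rewrite divr_gt0.
have := @conjugate_powR R S (V `^ (r - 1)) r (r / (r - 1)) S0 (powR_ge0 _ _) r0 q0.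
rewrite -powRrM (_ : (r - 1) * (r / (r - 1)) = r); last by field; rewrite gt_eqF.
have -> : r^-1 + (r / (r - 1))^-1 = 1 by field; rewrite !gt_eqF.
move=> /(_ erefl).
have VE : V `^ r = V * V `^ (r - 1).
  have [->|Vn0] := eqVneq V 0; first by rewrite powR0 ?mul0r ?gt_eqF.
  by rewrite mulrC -[V in _ * V]powRr1// -powRD ?Vn0 ?implybT// subrK.
rewrite -(ler_pM2l r0) mulrDr.
rewrite (_ : r * (S `^ r / r) = S `^ r); last by field; rewrite gt_eqF.
rewrite (_ : r * (V `^ r / (r / (r - 1))) = (r - 1) * V `^ r); last by field; rewrite !gt_eqF.
have -> : S = V - b by rewrite /V addrK.
rewrite VE; set p := V `^ (r - 1); lra.
Qed.

(** By the tangent inequality each new term [b j] costs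
    [r * S ^ (r - 1) * b j], where the partial sum [S] is at most [j + 1] because
    the terms are at most one. This is where the weights of [U1] come from. *)
Lemma powR_sum_le (b : nat -> R) (n : nat) r : 1 < r ->
  (forall j, 0 <= b j) -> (forall j, b j <= 1) ->
  (\sum_(0 <= j < n) b j) `^ r <= r * \sum_(0 <= j < n) j.+1%:R `^ (r - 1) * b j.
Proof.
move=> r1 b0 b1; have r0 : 0 < r by exact: lt_trans r1.
elim: n => [|n ih]; first by rewrite !big_geq// mulr0 powR0// gt_eqF.
rewrite !big_nat_recr//= mulrDr.
apply: (le_trans (powR_addr_le r1 _ (b0 n))); first exact: sumr_ge0.
apply: lerD => //; rewrite ler_wpM2l ?(ltW r0)// ler_wpM2r//.
apply: ge0_ler_powR; rewrite ?nnegrE ?subr_ge0 ?(ltW r1)//.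
  by rewrite addr_ge0// sumr_ge0.
rewrite -natr1 lerD//.
apply: (@le_trans _ _ (\sum_(0 <= j < n) 1)); first exact: ler_sum.
by rewrite big_const_nat subn0 iter_addr_0.
Qed.

(** For [s <= 1], [t <= t `^ s] on the unit interval, applied to the shares of [a]
    and [b] in their sum. *)
Lemma powR_add_le a b s : 0 <= a -> 0 <= b -> 0 < s -> s <= 1 ->
  (a + b) `^ s <= a `^ s + b `^ s.
Proof.
move=> a0 b0 s0 s1.
have [ab0|ab0] := eqVneq (a + b) 0.
  by rewrite ab0 powR0 ?gt_eqF// addr_ge0// powR_ge0.
have ab : 0 < a + b by rewrite lt_neqAle eq_sym ab0 addr_ge0.
have le1 t : 0 <= t -> t <= 1 -> t <= t `^ s.
  move=> t0 t1; have [->|tn0] := eqVneq t 0; first exact: powR_ge0.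
  rewrite -[leLHS]powRr1//; apply: ger_powR => //.
  by rewrite t1 andbT lt_neqAle eq_sym tn0.
have aE : a `^ s = (a + b) `^ s * (a / (a + b)) `^ s.
  by rewrite -powRM ?(ltW ab) ?divr_ge0 ?(ltW ab)// mulrC divfK.
have bE : b `^ s = (a + b) `^ s * (b / (a + b)) `^ s.
  by rewrite -powRM ?(ltW ab) ?divr_ge0 ?(ltW ab)// mulrC divfK.
rewrite aE bE -mulrDr -[leLHS]mulr1 ler_wpM2l ?powR_ge0//.
apply: (@le_trans _ _ (a / (a + b) + b / (a + b))).
  by rewrite -mulrDl divff.
apply: lerD; apply: le1; rewrite ?divr_ge0 ?(ltW ab)// ler_pdivrMr// mul1r.
  by rewrite lerDl.
by rewrite lerDr.
Qed.

End power_inequalities.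

(** * An integrable weight *)

Section integrable_weight.
Context {R : realType}.
Local Notation lambda := (@lebesgue_measure R).

Lemma integral_powRN_lty (alpha : R) : 1 < alpha ->
  (\int[lambda]_x ((1 + `|x|) `^ (- alpha))%:E < +oo)%E.
Proof.
move=> a1; have a10 : 0 < alpha - 1 by rewrite subr_gt0.
have pw (t : R) : 0 < t -> {for t, continuous (fun u : R => u `^ (- alpha))}.
  move=> t0; apply: differentiable_continuous; apply/derivable1_diffP/derivable_powR.
  by rewrite in_itv/= andbT.
have cf : continuous (fun x : R => (1 + `|x|) `^ (- alpha)).
  move=> x; have c1 : {for x, continuous (fun x : R => 1 + `|x|)}.
    by apply: continuousD; [exact: cvg_cst|exact: norm_continuous].
  have x1 : 0 < 1 + `|x| by rewrite ltr_pwDl.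
  exact: (continuous_comp c1 (pw _ x1)).
rewrite ge0_symfun_integralT//; last by move=> x /=; rewrite normrN.
apply: lte_mul_pinfty => //.
(* The primitive that vanishes at infinity. *)
pose F (x : R) : R := - (alpha - 1)^-1 * (1 + x) `^ (1 - alpha).
rewrite (_ : [set x | 0 <= x] = `[0, +oo[%classic); last by rewrite set_itvcy.
under eq_integral => x.
  rewrite inE/= in_itv/= andbT => x0; rewrite ger0_norm//; over.
have dF (x : R) : 0 <= x -> is_derive x 1 F ((1 + x) `^ (- alpha)).
  move=> x0; have x1 : 0 < 1 + x by rewrite ltr_pwDl.
  have d1 : is_derive x (1 : R) (fun x : R => 1 + x) (0 + 1).
    exact: (is_deriveD (is_derive_cst (1 : R) x 1) (is_derive_id x (1 : R))).
  have D := is_deriveZ (- (alpha - 1)^-1)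
    (is_derive1_comp (is_derive1_powR (1 - alpha) x1) d1).
  rewrite (_ : (1 + x) `^ (- alpha) =
      - (alpha - 1)^-1 *: ((1 - alpha) * (1 + x) `^ (1 - alpha - 1) * (0 + 1))) //.
  rewrite add0r mulr1 (_ : 1 - alpha - 1 = - alpha); last by ring.
  rewrite -(opprB alpha 1) /GRing.scale/= mulrA mulNr mulrN opprK mulVf ?mul1r//.
  by rewrite gt_eqF.
have F_cont (x : R) : 0 <= x -> {for x, continuous F}.
  by move=> x0; apply: differentiable_continuous; apply/derivable1_diffP; have := dF x x0.
rewrite (@ge0_continuous_FTC2y R (fun x => (1 + x) `^ (- alpha)) F 0 0).
- by rewrite -EFinB ltry.
- by move=> x _; exact: powR_ge0.
- apply: continuous_in_subspaceT => x; rewrite inE/= in_itv/= andbT => x0.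
  have c1 : {for x, continuous (fun x : R => 1 + x)}.
    by apply: continuousD; [exact: cvg_cst|exact: cvg_id].
  have x1 : 0 < 1 + x by rewrite ltr_pwDl.
  exact: (continuous_comp c1 (pw _ x1)).
- rewrite -[X in _ --> X](mulr0 (- (alpha - 1)^-1)); apply: cvgM; first exact: cvg_cst.
  apply/cvgrPdist_le => e e0; near=> x.
  have x0 : 0 < x by near: x; exact: nbhs_pinfty_gt.
  rewrite sub0r normrN ger0_norm ?powR_ge0//.
  have ex : e^-1 <= (1 + x) `^ (alpha - 1).
    have <- : (e^-1 `^ (alpha - 1)^-1) `^ (alpha - 1) = e^-1.
      by rewrite -powRrM mulVf ?gt_eqF// powRr1// invr_ge0 ltW.
    apply: ge0_ler_powR; rewrite ?nnegrE ?powR_ge0 ?(ltW a10)//.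
      by rewrite addr_ge0// ltW.
    have : e^-1 `^ (alpha - 1)^-1 < x.
      by near: x; apply: nbhs_pinfty_gt; rewrite num_real.
    by move=> /ltW/le_trans; apply; rewrite lerDr.
  rewrite -opprB powRN -(invrK e) lef_pV2 ?posrE// ?invr_gt0//.
  by rewrite powR_gt0// addr_gt0.
- by move=> x x0; have := dF x (ltW x0).
- by apply: cvg_at_right_filter; exact: F_cont.
- move=> x; rewrite in_itv/= andbT => x0; rewrite derive1E.
  by have := dF x (ltW x0) => dFx; rewrite derive_val.
Unshelve. all: by end_near. Qed.

End integrable_weight.

(** * Risk bounds *)

Section risk_bounds.
Context d (T : measurableType d) (R : realType) (P : probability T R).
Variable Y : int -> {RV P >-> R}.
Variable Q : forall k l : int,
  R.-pker (g_sigma_algebraType (past Y l)) ~> (measurableTypeR R).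
Variables f K : R -> R.
Variable h : nat -> R.
Hypothesis Y_stationary : strictly_stationary Y.
Hypothesis f_density : is_density Y f.
Hypothesis Q_cond : forall k l : int, is_cond_distribution k (Q k l).
Hypothesis K_int : lebesgue_measure.-integrable setT (EFin \o K).
Hypothesis K_bv : bounded_variationT K.
Hypothesis h_gt0 : forall n, (0 < n)%N -> 0 < h n.

Local Notation lambda := (@lebesgue_measure R).
Let dK := charge_norm (stieltjes_charge K_bv).
Let K1 := fine ('N[lebesgue_measure]_1[EFin \o K])%E.

Let K_measurable : measurable_fun setT K.
Proof. by apply/measurable_EFinP; exact: measurable_int K_int. Qed.

Let mnormK : measurable_fun setT (fun x : measurableTypeR R => `|K x|).
Proof. exact: measurableT_comp K_measurable. Qed.

Lemma integral_norm_kernel : (\int[lambda]_u `|K u|%:E)%E = K1%:E.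
Proof.
rewrite /K1 Lnorm1 fineK//; case/integrableP: K_int => _ Kfin.
by rewrite ge0_fin_numE//; apply: integral_ge0.
Qed.

Lemma K1_ge0 : 0 <= K1.
Proof. by rewrite fine_ge0// Lnorm_ge0. Qed.

(** The substitution [x = y + c * u] centers the kernel; its Jacobian [c] is the
    factor that cancels one power of the bandwidth. *)
Lemma kernel_integral (om : measurableTypeR R -> R) (y c : R) : 0 < c ->
  measurable_fun setT om -> (forall x, 0 <= om x) ->
  (\int[lambda]_x (om x * `|K (c^-1 * (x - y))|)%:E =
   c%:E * \int[lambda]_u (om (y + c * u) * `|K u|)%:E)%E.
Proof.
move=> c0 mom om0.
have maff : measurable_fun setT
    (fun u : measurableTypeR R => y + c * u : measurableTypeR R).
  by apply: measurable_funD => //; exact: measurable_funM.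
have mdil : measurable_fun setT
    (fun x : measurableTypeR R => c^-1 * (x - y) : measurableTypeR R).
  by apply: measurable_funM => //; exact: measurable_funB.
rewrite (ge0_integral_affine y c0); last 2 first.
- by apply: measurable_funM => //; exact: measurableT_comp mnormK mdil.
- by move=> x; rewrite mulr_ge0.
rewrite -ge0_integralZl_EFin ?(ltW c0)//; last 2 first.
- by move=> x _; rewrite lee_fin mulr_ge0.
- by apply/measurable_EFinP; apply: measurable_funM => //; exact: measurableT_comp mom maff.
apply: eq_integral => u _; rewrite -EFinM; congr (_ * (_ * `|K _|))%:E.
by rewrite addrAC subrr add0r mulKf// gt_eqF.
Qed.

Lemma integral_b_coef k : \int[P]_w b_coef Q 0 k%:Z w = beta1 Q k.
Proof. by rewrite /beta1 unlock. Qed.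

Lemma beta1_ge0 k : 0 <= beta1 Q k.
Proof. by rewrite -integral_b_coef; apply: Rintegral_ge0 => w _; exact: b_coef_ge0. Qed.

Lemma integral_b_sum n : \int[P]_w b_sum Q n w = V12 Q n.
Proof.
rewrite /b_sum bounded_integral_sum; last by move=> j; exact: bounded_measurable_b_coef.
by apply: eq_bigr => j _; rewrite integral_b_coef.
Qed.

Lemma V12_ge0 n : 0 <= V12 Q n.
Proof. by apply: sumr_ge0 => j _; exact: beta1_ge0. Qed.

Lemma integral_powR_law a : (\int[P]_w (`|Y 0 w| `^ a)%:E)%E = moment a f.
Proof.
have mpow : measurable_fun setT (fun y : measurableTypeR R => `|y| `^ a).
  by apply: measurableT_comp (measurable_powR a) _; exact: normr_measurable.
have [mf f0 fE] := f_density.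
have pow0 (y : measurableTypeR R) : 0 <= `|y| `^ a by exact: powR_ge0.
have lawE1 B : measurable B ->
    law Y 0 B = (\int[P]_(w in Y 0 @^-1` B) (cst (1 : R) w)%:E)%E.
  move=> mB; rewrite (integral_cst _ _ 1%:E) ?mul1e//.
  by rewrite -[_ @^-1` _]setTI; exact: (measurable_Y Y 0 measurableT mB).
have lawE2 (B : set (measurableTypeR R)) : measurable B ->
    law Y 0 B = (\int[lambda]_(x in idfun @^-1` B) (f x)%:E)%E.
  by move=> mB; rewrite -fE.
have m1 : measurable_fun setT (cst 1 : T -> R) by [].
transitivity (\int[law Y 0]_y (`|y| `^ a)%:E)%E.
  rewrite (ge0_integral_density (measurable_Y Y 0) m1 (fun=> ler01) lawE1 mpow pow0).
  by apply: eq_integral => w _; rewrite mulr1.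
have mid : measurable_fun setT (idfun : measurableTypeR R -> measurableTypeR R).
  exact: measurable_id.
have mf' : measurable_fun setT (f : measurableTypeR R -> R) by exact: mf.
rewrite (ge0_integral_density mid mf' f0 lawE2 mpow pow0) /moment.
by apply: eq_integral.
Qed.

Lemma risk_weighted_2 n : risk Y K h 2 n =
  (\int[P]_w \int[lambda]_x (1 * centered_estimator Y K h n w x ^+ 2)%:E)%E.
Proof.
apply: eq_integral => w _; apply: eq_integral => x _.
by rewrite mul1r -[in LHS]/(centered_estimator Y K h n w x) powR_mulrn// real_normK ?num_real.
Qed.

Lemma risk_2_le n : (0 < n)%N ->
  (risk Y K h 2 n <= (2 / (n%:R * h n) * dK * K1 * V12 Q n)%:E)%E.
Proof.
move=> n0; have hn := h_gt0 n0; rewrite risk_weighted_2.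
apply: (le_trans (weighted_variance_le (om := cst 1) (Phi := cst (h n * K1))
  Y_stationary f_density Q_cond K_measurable K_bv h_gt0 n0 _ _ _ _ _)) => //.
- by move=> x /=; rewrite mulr_ge0 ?K1_ge0// ltW.
- move=> y; rewrite (kernel_integral (om := cst 1))// EFinM.
  by under eq_integral do rewrite mul1r; rewrite integral_norm_kernel.
have bS := bounded_measurable_b_sum Q n.
have bPhi := bounded_measurableM (@bounded_measurable_cst _ T R (h n * K1)) bS.
rewrite -EFin_bounded_integral// bounded_integralZl// integral_b_sum -EFinM lee_fin.
rewrite -/dK; move: dK (K1 : R) (V12 Q n) => D k v.
rewrite le_eqVlt; apply/orP; left; apply/eqP; field.
by rewrite pnatr_eq0 -lt0n n0 gt_eqF.
Qed.

(** The Hoelder inequality with exponents [q] and [r = q / (q - 1)] separates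
    [Y 0] from the coefficients, and [powR_sum_le] with this [r] has the weights
    [(j + 1) ^ (r - 1) = (j + 1) ^ (1 / (q - 1))]. *)
Lemma moment_b_sum_le (s q : R) n : 1 < q -> (moment (s * q) f < +oo)%E ->
  (\int[P]_w (`|Y 0 w| `^ s * b_sum Q n w)%:E <=
   (fine (moment (s * q) f) `^ (1 / q) *
    (q / (q - 1) * U1 Q q n) `^ ((q - 1) / q))%:E)%E.
Proof.
move=> q1 Mfin; have q0 : 0 < q by exact: lt_trans q1.
have q10 : 0 < q - 1 by rewrite subr_gt0.
set r := q / (q - 1).
have r1 : 1 < r by rewrite /r ltr_pdivlMr// mul1r ltrBlDr ltrDl.
have r0 : 0 < r by exact: lt_trans r1.
have rE : r - 1 = 1 / (q - 1) by rewrite /r; field; rewrite gt_eqF.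
have a0 : 0 < 1 / q by rewrite divr_gt0.
have a1 : 1 / q < 1 by rewrite ltr_pdivrMr// mul1r.
have aE : 1 - 1 / q = (q - 1) / q by field; rewrite gt_eqF.
have [mb _] := bounded_measurable_b_sum Q n.
have mY : measurable_fun setT (fun w => `|Y 0 w|) by exact: measurableT_comp.
have mYsq : measurable_fun setT (fun w => `|Y 0 w| `^ (s * q)).
  exact: measurableT_comp (measurable_powR (s * q)) mY.
have mbr : measurable_fun setT (fun w => b_sum Q n w `^ r).
  exact: measurableT_comp (measurable_powR r) mb.
have fM : (\int[P]_w (`|Y 0 w| `^ (s * q))%:E <= (fine (moment (s * q) f))%:E)%E.
  rewrite integral_powR_law fineK// ge0_fin_numE//.
  by rewrite -integral_powR_law; apply: integral_ge0 => w _; rewrite lee_fin powR_ge0.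
have bterm j : bounded_measurable (fun w => j.+1%:R `^ (r - 1) * b_coef Q 0 j%:Z w).
  apply: bounded_measurableM; first exact: bounded_measurable_cst.
  exact: bounded_measurable_b_coef.
have bsum : bounded_measurable (fun w =>
    \sum_(0 <= j < n.+1) j.+1%:R `^ (r - 1) * b_coef Q 0 j%:Z w).
  exact: bounded_measurable_sum.
have gU : (\int[P]_w (b_sum Q n w `^ r)%:E <= (r * U1 Q q n)%:E)%E.
  apply: (@le_trans _ _ (\int[P]_w
      (r * \sum_(0 <= j < n.+1) j.+1%:R `^ (r - 1) * b_coef Q 0 j%:Z w)%:E)%E).
    apply: ge0_le_integral => //.
    - by move=> w _; rewrite lee_fin powR_ge0.
    - exact/measurable_EFinP.
    - apply/measurable_EFinP; apply: measurable_funM => //; by case: bsum.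
    - move=> w _; rewrite lee_fin; apply: powR_sum_le => // j.
        exact: b_coef_ge0.
      exact: b_coef_le1.
  rewrite -EFin_bounded_integral; last first.
    by apply: bounded_measurableM => //; exact: bounded_measurable_cst.
  rewrite bounded_integralZl// bounded_integral_sum// lee_fin ler_wpM2l ?(ltW r0)//.
  rewrite /U1 -rE le_eqVlt; apply/orP; left; apply/eqP; apply: eq_bigr => j _.
  by rewrite bounded_integralZl ?integral_b_coef//; exact: bounded_measurable_b_coef.
have := ge0_hoelder_powR mYsq mbr (fun=> powR_ge0 _ _) (fun=> powR_ge0 _ _) a0 a1 fM gU.
rewrite aE; apply: le_trans; rewrite le_eqVlt; apply/orP; left; apply/eqP.
apply: eq_integral => w _; congr (_ * _)%:E.
  by rewrite -powRrM mul1r mulfK// gt_eqF.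
rewrite -powRrM /r (_ : q / (q - 1) * ((q - 1) / q) = 1); last by field; rewrite !gt_eqF.
by rewrite powRr1// b_sum_ge0.
Qed.

(** After centering, the weight [1 + |y + c * u|] is at most
    [1 + |y| + c * |u|], and its power splits into three: the first two are
    integrated against [||K||_1], the last one is the moment of [K]. *)
Lemma weighted_kernel_le (s y c : R) : 0 <= s -> 0 < c ->
  (moment s (fun x => `|K x|%R) < +oo)%E ->
  (\int[lambda]_x ((1 + `|x|) `^ s * `|K (c^-1 * (x - y))|)%:E <=
   (3 `^ s * c * ((1 + `|y| `^ s) * K1
      + c `^ s * fine (moment s (fun x => `|K x|%R))))%:E)%E.
Proof.
move=> s0 c0 MKfin; set MK := fine _.
have mpow : measurable_fun setT (fun u : measurableTypeR R => `|u| `^ s).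
  by apply: measurableT_comp (measurable_powR s) _; exact: normr_measurable.
have mom : measurable_fun setT (fun x : measurableTypeR R => (1 + `|x|) `^ s).
  by apply: measurableT_comp (measurable_powR s) _; exact: measurable_funD.
have MKE : (\int[lambda]_u (`|u| `^ s * `|K u|)%:E = MK%:E)%E.
  rewrite /MK fineK// ge0_fin_numE//; apply: integral_ge0 => u _.
  by rewrite lee_fin mulr_ge0// powR_ge0.
rewrite (kernel_integral _ c0 mom); last by move=> x; exact: powR_ge0.
rewrite -mulrA mulrCA EFinM; apply: lee_wpmul2l; first by rewrite lee_fin ltW.
apply: (@le_trans _ _ (\int[lambda]_u ((3 `^ s * (1 + `|y| `^ s))%:E * `|K u|%:E
    + (3 `^ s * c `^ s)%:E * (`|u| `^ s * `|K u|)%:E))%E).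
  apply: ge0_le_integral => //.
  - have maff : measurable_fun setT
    (fun u : measurableTypeR R => y + c * u : measurableTypeR R).
      by apply: measurable_funD => //; exact: measurable_funM.
    have mK : measurable_fun setT (fun u : measurableTypeR R => (1 + `|y + c * u|) `^ s).
      apply: measurableT_comp (measurable_powR s) _; apply: measurable_funD => //.
      by apply: measurableT_comp maff.
    apply/measurable_EFinP; exact: (measurable_funM mK mnormK).
  - by apply: emeasurable_funD; apply: measurable_funeM; apply/measurable_EFinP => //;
      exact: measurable_funM.
  move=> u _; rewrite -!EFinM -EFinD lee_fin.
  rewrite [leRHS](_ : _ = 3 `^ s * (1 + `|y| `^ s + c `^ s * `|u| `^ s) * `|K u|);
    last by ring.
  rewrite ler_wpM2r//.
  have cu0 : 0 <= c * `|u| by rewrite mulr_ge0// ltW.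
  have := powR_add3_le ler01 (normr_ge0 y) cu0 s0.
  rewrite powR1 powRM ?(ltW c0)//; apply: le_trans.
  apply: ge0_ler_powR; rewrite ?nnegrE ?addr_ge0//.
  rewrite -addrA lerD2l (le_trans (ler_normD _ _))// normrM (gtr0_norm c0).
  by rewrite lerD2l.
have k1 : 0 <= 3 `^ s * (1 + `|y| `^ s) by rewrite mulr_ge0 ?powR_ge0// addr_ge0// powR_ge0.
have k2 : 0 <= 3 `^ s * c `^ s by rewrite mulr_ge0 ?powR_ge0.
have mpK : measurable_fun setT (fun u : measurableTypeR R => (`|u| `^ s * `|K u|)%:E).
  by apply/measurable_EFinP; exact: (measurable_funM mpow mnormK).
have mK : measurable_fun setT (fun u : measurableTypeR R => `|K u|%:E).
  exact/measurable_EFinP.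
have pK0 (u : measurableTypeR R) : setT u -> (0 <= (`|u| `^ s * `|K u|)%:E)%E.
  by move=> _; rewrite lee_fin mulr_ge0// powR_ge0.
rewrite ge0_integralD//; first last.
- exact: measurable_funeM.
- by move=> u _; rewrite mule_ge0 ?lee_fin ?mulr_ge0 ?powR_ge0.
- exact: measurable_funeM.
rewrite ge0_integralZl_EFin// (ge0_integralZl_EFin _ _ pK0 mpK k2)//.
rewrite integral_norm_kernel MKE -!EFinM -EFinD lee_fin.
by rewrite le_eqVlt; apply/orP; left; apply/eqP; move: (K1 : R) => k; ring.
Qed.

(** The Hoelder inequality with exponents [2 / p] and [2 / (2 - p)] on the product
    space. The weight [(1 + |x|) ^ s] is compensated exactly by the power
    [1 - p / 2] of [(1 + |x|) ^ (- alpha)], since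
    [s * (p / 2) = alpha * (1 - p / 2)]: this fixes the exponent [s]. *)
Lemma risk_le_weighted (p alpha A : R) n : 1 <= p -> p < 2 -> 1 < alpha ->
  (\int[P]_w \int[lambda]_x ((1 + `|x|) `^ (alpha * (2 - p) / p)
      * centered_estimator Y K h n w x ^+ 2)%:E <= A%:E)%E ->
  (risk Y K h p n <= (A `^ (p / 2) *
     fine (\int[lambda]_x ((1 + `|x|) `^ (- alpha))%:E) `^ (1 - p / 2))%:E)%E.
Proof.
move=> p1 p2 al1; set s := alpha * (2 - p) / p => DA.
have p0 : 0 < p by exact: lt_le_trans p1.
have mD := measurable_centered_estimator Y h K_measurable K_bv n.
have m1x : measurable_fun setT (fun z : T * measurableTypeR R => 1 + `|z.2|).
  by apply: measurable_funD => //; exact: measurableT_comp.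
pose F (z : T * measurableTypeR R) :=
  (1 + `|z.2|) `^ s * centered_estimator Y K h n z.1 z.2 ^+ 2.
pose G (z : T * measurableTypeR R) := (1 + `|z.2|) `^ (- alpha).
have mF : measurable_fun setT F.
  apply: measurable_funM; first exact: measurableT_comp (measurable_powR s) m1x.
  exact: measurable_funX.
have mG : measurable_fun setT G by exact: measurableT_comp (measurable_powR _) m1x.
have F0 z : 0 <= F z by rewrite mulr_ge0 ?powR_ge0 ?sqr_ge0.
have G0 z : 0 <= G z by exact: powR_ge0.
have FA : (\int[(P \x lambda)%E]_z (F z)%:E <= A%:E)%E.
  by rewrite fubini_tonelli1//; exact/measurable_EFinP.
have GW : (\int[(P \x lambda)%E]_z (G z)%:E <=
    (fine (\int[lambda]_x ((1 + `|x|) `^ (- alpha))%:E))%:E)%E.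
  rewrite fubini_tonelli1//; last exact/measurable_EFinP.
  set W := (\int[lambda]_x _)%E; rewrite [leLHS](_ : _ = \int[P]_x (cst W x))%E//.
  rewrite integral_cst// -[X in (_ * X)%E]/(P setT) probability_setT mule1.
  rewrite fineK// ge0_fin_numE.
    exact: integral_powRN_lty.
  by apply: integral_ge0 => x _; rewrite lee_fin powR_ge0.
have a0 : 0 < p / 2 by rewrite divr_gt0.
have a1 : p / 2 < 1 by rewrite ltr_pdivrMr// mul1r.
apply: le_trans (ge0_hoelder_powR mF mG F0 G0 a0 a1 FA GW).
have mFG : measurable_fun setT (fun z => (F z `^ (p / 2) * G z `^ (1 - p / 2))%:E).
  apply/measurable_EFinP; apply: measurable_funM.
    exact: measurableT_comp (measurable_powR _) mF.
  exact: measurableT_comp (measurable_powR _) mG.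
have FG0 z : (0 <= (F z `^ (p / 2) * G z `^ (1 - p / 2))%:E)%E.
  by rewrite lee_fin mulr_ge0// powR_ge0.
rewrite (fubini_tonelli1 _ mFG FG0).
rewrite le_eqVlt; apply/orP; left; apply/eqP.
apply: eq_integral => w _; apply: eq_integral => x _; congr (_%:E).
rewrite -[in LHS]/(centered_estimator Y K h n w x) /F /G/=.
rewrite powRM ?powR_ge0 ?sqr_ge0// -[X in _ * X `^ (p / 2) * _]real_normK ?num_real//.
rewrite -(powR_mulrn 2 (normr_ge0 _)) -!powRrM mulrAC -powRD; last first.
  by apply/implyP => _; rewrite gt_eqF// ltr_pwDl.
rewrite (_ : s * (p / 2) + - alpha * (1 - p / 2) = 0); last first.
  by rewrite /s; field; rewrite gt_eqF.
by rewrite powRr0 mul1r mulrC divfK.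
Qed.

Lemma weighted_risk_le (s q : R) n : 0 <= s -> 1 < q -> (0 < n)%N ->
  (moment s (fun x => `|K x|%R) < +oo)%E -> (moment (s * q) f < +oo)%E ->
  (\int[P]_w \int[lambda]_x ((1 + `|x|) `^ s * centered_estimator Y K h n w x ^+ 2)%:E <=
   (2 * 3 `^ s *
    (dK * K1 * (fine (moment (s * q) f) `^ (1 / q) *
                (q / (q - 1) * U1 Q q n) `^ ((q - 1) / q)) / (n%:R * h n)
     + dK * (K1 + h n `^ s * fine (moment s (fun x => `|K x|%R))) * V12 Q n
         / (n%:R * h n)))%:E)%E.
Proof.
move=> s0 q1 n0 MKfin Mfin; have hn := h_gt0 n0.
set MK := fine (moment s _); set m := _ `^ (1 / q) * _.
have mpow : measurable_fun setT (fun u : measurableTypeR R => `|u| `^ s).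
  by apply: measurableT_comp (measurable_powR s) _; exact: normr_measurable.
have mom : measurable_fun setT (fun x : measurableTypeR R => (1 + `|x|) `^ s).
  by apply: measurableT_comp (measurable_powR s) _; exact: measurable_funD.
have MK0 : 0 <= MK.
  by rewrite fine_ge0//; apply: integral_ge0 => x _; rewrite lee_fin mulr_ge0// powR_ge0.
have hMK0 : 0 <= h n `^ s * MK by rewrite mulr_ge0// powR_ge0.
have sh0 : 0 <= 3 `^ s * h n by rewrite mulr_ge0 ?powR_ge0// ltW.
pose Phi (y : measurableTypeR R) : R :=
  3 `^ s * h n * ((1 + `|y| `^ s) * K1 + h n `^ s * MK).
have mPhi : measurable_fun setT Phi.
  apply: measurable_funM => //; apply: measurable_funD => //.
  by apply: measurable_funM => //; exact: measurable_funD.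
have Phi0 y : 0 <= Phi y.
  by rewrite mulr_ge0// addr_ge0// mulr_ge0 ?K1_ge0// addr_ge0// powR_ge0.
have := weighted_variance_le Y_stationary f_density Q_cond K_measurable K_bv h_gt0 n0
  mom (fun=> powR_ge0 _ _) mPhi Phi0 (fun y => weighted_kernel_le y s0 hn MKfin).
move=> /le_trans; apply.
have [mb _] := bounded_measurable_b_sum Q n.
have mYs : measurable_fun setT (fun w => `|Y 0 w| `^ s).
  by apply: measurableT_comp (measurable_powR s) _; exact: measurableT_comp.
have k1 : 0 <= 3 `^ s * h n * (K1 + h n `^ s * MK) by rewrite mulr_ge0 ?addr_ge0 ?K1_ge0.
have k2 : 0 <= 3 `^ s * h n * K1 by rewrite mulr_ge0 ?K1_ge0.
have PhiE : (\int[P]_w (Phi (Y 0 w) * b_sum Q n w)%:E =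
    (3 `^ s * h n * (K1 + h n `^ s * MK))%:E * \int[P]_w (b_sum Q n w)%:E
    + (3 `^ s * h n * K1)%:E * \int[P]_w (`|Y 0 w| `^ s * b_sum Q n w)%:E)%E.
  have mb' : measurable_fun setT (fun w => (b_sum Q n w)%:E) by exact/measurable_EFinP.
  have mYb : measurable_fun setT (fun w => (`|Y 0 w| `^ s * b_sum Q n w)%:E).
    by apply/measurable_EFinP; exact: measurable_funM.
  have b0 w : setT w -> (0 <= (b_sum Q n w)%:E)%E by rewrite lee_fin b_sum_ge0.
  have Yb0 w : setT w -> (0 <= (`|Y 0 w| `^ s * b_sum Q n w)%:E)%E.
    by rewrite lee_fin mulr_ge0 ?powR_ge0 ?b_sum_ge0.
  rewrite -(ge0_integralZl_EFin _ _ b0 mb' k1)// -(ge0_integralZl_EFin _ _ Yb0 mYb k2)//.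
  rewrite -ge0_integralD//; first last.
  - exact: measurable_funeM.
  - by move=> w _; rewrite mule_ge0 ?lee_fin// mulr_ge0 ?powR_ge0 ?b_sum_ge0.
  - exact: measurable_funeM.
  - by move=> w _; rewrite mule_ge0 ?lee_fin// b_sum_ge0.
  apply: eq_integral => w _; rewrite -!EFinM -EFinD; congr (_%:E).
  rewrite /Phi; move: (K1 : R) => k; ring.
have C0 : 0 <= 2 * dK / (n%:R * h n ^+ 2).
  apply: divr_ge0; first by rewrite mulr_ge0// charge_norm_ge0.
  by rewrite mulr_ge0// exprn_ge0// ltW.
rewrite PhiE -EFin_bounded_integral; last exact: bounded_measurable_b_sum.
rewrite integral_b_sum.
apply: (@le_trans _ _ ((2 * dK / (n%:R * h n ^+ 2))%:E *
    ((3 `^ s * h n * (K1 + h n `^ s * MK))%:E * (V12 Q n)%:E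
     + (3 `^ s * h n * K1)%:E * m%:E))%E).
  apply: lee_wpmul2l; first by rewrite lee_fin.
  apply: leeD2l; apply: lee_wpmul2l; first by rewrite lee_fin.
  exact: moment_b_sum_le.
rewrite [leLHS](_ : _ = (2 * dK / (n%:R * h n ^+ 2) *
    (3 `^ s * h n * (K1 + h n `^ s * MK) * V12 Q n + 3 `^ s * h n * K1 * m))%:E)//.
rewrite lee_fin le_eqVlt; apply/orP; left; apply/eqP.
move: dK (K1 : R) (V12 Q n) m MK (h n `^ s) (3 `^ s)
  {C0 k1 k2 PhiE sh0 Phi mPhi Phi0 hMK0 MK0}.
move=> D k v m' M hs t; field.
by rewrite pnatr_eq0 -lt0n n0 gt_eqF.
Qed.

End risk_bounds.

Theorem proposition3p2 (d : measure_display) (T : measurableType d) (R : realType)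
    (P : probability T R) (Y : int -> {RV P >-> R})
    (Q : forall k l : int,
       R.-pker (g_sigma_algebraType (past Y l)) ~> (measurableTypeR R))
    (f K : R -> R) (h : nat -> R)
    (Y_stationary : strictly_stationary Y)
    (f_density : is_density Y f)
    (Q_cond : forall k l : int, is_cond_distribution k (Q k l))
    (K_int : lebesgue_measure.-integrable setT (EFin \o K))
    (K_bv : bounded_variationT K)
    (h_gt0 : forall n : nat, (0 < n)%N -> 0 < h n) :
  let dK := charge_norm (stieltjes_charge K_bv) in
  let K1 := fine ('N[lebesgue_measure]_1[EFin \o K])%E in
  (exists2 C : R, 0 < C & forall n : nat, (0 < n)%N ->
    (risk Y K h 2 n <= (C / (n%:R * h n) * dK * K1 * V12 Q n)%:E)%E)
  /\
  (forall p alpha q : R, 1 <= p -> p < 2 -> 1 < alpha -> 1 < q ->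
    let Mf := moment (alpha * q * (2 - p) / p) f in
    let MK := moment (alpha * (2 - p) / p) (fun x => `|K x|) in
    (Mf < +oo)%E -> (MK < +oo)%E ->
    exists2 C : R, 0 < C & forall n : nat, (0 < n)%N ->
      (risk Y K h p n <=
        (C * (dK * K1 * fine Mf `^ (1 / q) * U1 Q q n `^ ((q - 1) / q)
                / (n%:R * h n)) `^ (p / 2)
         + C * (dK * (K1 + h n `^ (alpha * (2 - p) / p) * fine MK) * V12 Q n
                / (n%:R * h n)) `^ (p / 2))%:E)%E).
Proof.
move=> dK K1; split.
  by exists 2 => // n n0; exact: (risk_2_le Y_stationary f_density Q_cond K_int K_bv h_gt0 n0).
move=> p alpha q p1 p2 al1 q1.
set s := alpha * (2 - p) / p.
have -> : alpha * q * (2 - p) / p = s * q by rewrite /s; ring.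
move=> Mf MK Mfin MKfin.
have p0 : 0 < p by exact: lt_le_trans p1.
have s0 : 0 <= s by rewrite /s divr_ge0 ?(ltW p0)// mulr_ge0; lra.
have q0 : 0 < q by exact: lt_trans q1.
have q10 : 0 < q - 1 by rewrite subr_gt0.
set r := q / (q - 1); have r0 : 0 < r by rewrite /r divr_gt0.
set W := fine (\int[lebesgue_measure]_x ((1 + `|x|) `^ (- alpha))%:E)%E.
have W0 : 0 <= W by rewrite fine_ge0//; apply: integral_ge0 => x _; rewrite lee_fin powR_ge0.
have p20 : 0 < p / 2 by rewrite divr_gt0.
have p21 : p / 2 <= 1 by rewrite ler_pdivrMr// mul1r ltW.
pose cr := r `^ ((q - 1) / q); have cr0 : 0 <= cr by exact: powR_ge0.
(* The constant collects the factor 2 * 3 ^ s of the weighted variance and the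
   integral W of (1 + |x|) ^ (- alpha), raised to the powers coming from the
   Hoelder inequality; W + 1 replaces W to make positivity immediate. The factor
   cr is what the constant r of the power inequality becomes after the root. *)
pose c := (2 * 3 `^ s) `^ (p / 2) * (W + 1) `^ (1 - p / 2).
have c0 : 0 < c.
  by rewrite /c mulr_gt0 ?powR_gt0 ?mulr_gt0 ?powR_gt0// ltr_wpDl.
exists (c * (1 + cr `^ (p / 2))) => [|n n0].
  by rewrite mulr_gt0// ltr_pwDl// powR_ge0.
have := weighted_risk_le Y_stationary f_density Q_cond K_int K_bv h_gt0 s0 q1 n0 MKfin Mfin.
move=> /(risk_le_weighted K_int K_bv p1 p2 al1)/le_trans; apply.
have hn := h_gt0 n n0; have nh0 : 0 < n%:R * h n by rewrite mulr_gt0// ltr0n.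
have dK0 : 0 <= dK := charge_norm_ge0 K_bv.
have K10 : 0 <= K1 := K1_ge0 K.
have V0 : 0 <= V12 Q n := V12_ge0 Q n.
have U0 : 0 <= U1 Q q n.
  by apply: sumr_ge0 => j _; rewrite mulr_ge0 ?powR_ge0 ?beta1_ge0.
have MK0 : 0 <= fine MK.
  by rewrite fine_ge0//; apply: integral_ge0 => x _; rewrite lee_fin mulr_ge0// powR_ge0.
set X1 := dK * K1 * fine Mf `^ (1 / q) * U1 Q q n `^ ((q - 1) / q) / (n%:R * h n).
set X2 := dK * (K1 + h n `^ s * fine MK) * V12 Q n / (n%:R * h n).
have X10 : 0 <= X1 by rewrite /X1 divr_ge0 ?(ltW nh0)// !mulr_ge0// powR_ge0.
have X20 : 0 <= X2.
  by rewrite /X2 divr_ge0 ?(ltW nh0)// !mulr_ge0// addr_ge0// mulr_ge0// powR_ge0.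
rewrite lee_fin (powRM _ (ltW r0) U0) -/cr -/W -/dK -/K1 -/Mf.
rewrite [X in 2 * 3 `^ s * (X + _)](_ : _ = cr * X1); last first.
  by rewrite /X1; generalize dK (K1 : R) => D k; ring.
have a0 : 0 <= 2 * 3 `^ s by rewrite mulr_ge0// powR_ge0.
have crX0 : 0 <= cr * X1 by rewrite mulr_ge0.
rewrite powRM ?addr_ge0//.
apply: (@le_trans _ _ (c * (cr `^ (p / 2) * X1 `^ (p / 2) + X2 `^ (p / 2)))).
  rewrite /c mulrAC; apply: ler_pM; rewrite ?mulr_ge0 ?powR_ge0//.
    apply: ler_wpM2l; first exact: powR_ge0.
    apply: ge0_ler_powR; rewrite ?nnegrE ?subr_ge0 ?addr_ge0//.
    by rewrite lerDl.
  by rewrite -powRM//; exact: powR_add_le.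
rewrite -[c * _ * X1 `^ _]mulrA -[c * _ * X2 `^ _]mulrA -mulrDr.
apply: ler_wpM2l; first exact: ltW.
rewrite !mulrDl !mul1r.
have := powR_ge0 X1 (p / 2); have := mulr_ge0 (powR_ge0 cr (p / 2)) (powR_ge0 X2 (p / 2)).
lra.
Qed.
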